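(* Suppose that: (A) $F:\mathbb{R}^d\to\mathbb{R}$ is continuously differentiable and $\|\nabla F(x')-\nabla F(x)\|_2\le L\|x'-x\|_2$ for all $x,x'\in\mathbb{R}^d$, with $0<L<\infty$; (B) $F$ is strongly convex with constant $l>0$: $F(x')\ge F(x)+\nabla F(x)^{\mathrm T}(x'-x)+\frac l2\|x'-x\|_2^2$ for all $x,x'$, with unique minimizer $x_*$ and $F_*=F(x_* )$; (C) the random directions $\zeta_k$ satisfy the direction assumption of the context; (D) the variance assumption of the context holds with constants $M,M_V\ge 0$. Let $M_G=M_V+2$ and $M_d=M+\frac{5d^3D_\zeta^2}{4}$. Suppose that the SGFD method is run with the stepsizes $\alpha_k=\frac{\beta}{k+\sigma}$, $k\in\mathbb{N}$, where $\beta>\frac1l$ and $\sigma>0$ are such that $\alpha_1\le\frac{1}{LM_G}$. Then there are constants $C_A,C_B>0$ independent of $k$ such that, for every $k\in\mathbb{N}$, $$\mathbb{E}[F(x_k)]-F_*\le \frac{C_A\,\Gamma(1+\sigma)}{\Gamma(1+\sigma-\beta l)}\,\frac{F(x_1)-F_*}{(k+1+\sigma)^{\beta l}}+\frac{C_B\,\beta^2}{2(\beta l-1)}\,\frac{LM_d}{k+1+\sigma}.$$ Since $\beta l>1$, it holds that $\mathbb{E}[F(x_k)]-F_*=\mathcal{O}(1/k)$.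
   Context: $F(x)=\mathbb{E}_\xi[f(x,\xi)]=\int_\Xi f(x,\xi)\,dP(\xi)$ for a collection of real-valued functions $f(\cdot,\xi)$ on $\mathbb{R}^d$ and a probability distribution $P$ on $\Xi$. SGFD method: from a given $x_1\in\mathbb{R}^d$, $x_{k+1}=x_k+s(x_k,\xi_k,\alpha_k,\zeta_k)$ with stepsize $\alpha_k>0$, where the step is one of the following four choices ($n_k,q_k$ are positive integer sample sizes, all $\xi$'s are distributed as $P$, all $\zeta$'s with index $k$ as $\zeta_k$): (1) $(f(x_k,\xi_k)-f(x_k+\alpha_k\zeta_k,\xi_k))\zeta_k$; (2) $\frac1{n_k}\sum_{i=1}^{n_k}(f(x_k,\xi_{k,i})-f(x_k+\alpha_k\zeta_k,\xi_{k,i}))\zeta_k$; (3) $\frac1{n_k}\sum_{i=1}^{n_k}\big[\frac1{q_k}\sum_{j=1}^{q_k}(f(x_k,\xi_{k,i,j})-f(x_k+\alpha_k\zeta_{k,i},\xi_{k,i,j}))\big]\zeta_{k,i}$; (4) $\frac1{n_k}\sum_{i=1}^{n_k}(f(x_k,\xi_{k,i})-f(x_k+\alpha_k\zeta_{k,i},\xi_{k,i}))\zeta_{k,i}$. The random variables $\{\xi_k\}$, $\{\zeta_k\}$ are i.i.d. over $k$ and jointly independent, so that $\mathbb{E}_{\xi_k,\zeta_k}[s(x_k,\xi_k,\alpha_k,\zeta_k)]=\mathbb{E}_{\zeta_k}[(F(x_k)-F(x_k+\alpha_k\zeta_k))\zeta_k]$. Here $\mathbb{E}_{\xi_k,\zeta_k}$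 is the expectation over the $k$-th seeds with $x_k$ held fixed, and $\mathbb{E}$ is the total expectation over all random variables. Direction assumption: the $\zeta_k\in\mathbb{R}^d$ are i.i.d.; $\mathbb{E}[\zeta_k^{(i)}]=0$ for all $i$; $\mathbb{E}[\zeta_k^{(i)}\zeta_k^{(j)}]=1$ if $i=j$ and $0$ otherwise; and every component is bounded, $|\zeta_k^{(i)}|\le r_\zeta$ for all $i$, or has a finite nonzero fourth moment, $\mathbb{E}[(\zeta_k^{(i)})^4]\le m_\zeta^{(4)}$ for all $i$. Set $D_\zeta=\min\big(r_\zeta,\sqrt{1+m_\zeta^{(4)}/d-1/d}\big)$ (an unavailable bound is read as $+\infty$). Variance assumption: for all $k\in\mathbb{N}$, $\mathbb{V}_{\xi_k,\zeta_k}[s(x_k,\xi_k,\alpha_k,\zeta_k)]\le\alpha_k^2M+\alpha_k^2M_V\|\nabla F(x_k)\|_2^2$, where $\mathbb{V}_\theta[s]=\mathbb{E}_\theta[\|s\|_2^2]-\|\mathbb{E}_\theta[s]\|_2^2$. $\Gamma$ is the gamma function. *)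

(* Defs.v *)
From HB Require Import structures.
From mathcomp Require Import all_boot all_order all_algebra finmap.
From mathcomp Require Import all_classical all_reals all_analysis.

Set Implicit Arguments.
Unset Strict Implicit.
Unset Printing Implicit Defensive.

Import Order.TTheory GRing.Theory Num.Theory.
Import numFieldNormedType.Exports.

Local Open Scope classical_set_scope.
Local Open Scope ring_scope.

Definition measure_rV_display : measure_display. Proof. by []. Qed.

(* R^d carries the product sigma-algebra, i.e. the one generated by the
   coordinate maps; it coincides with the Borel sigma-algebra. *)
Section measurable_rV.
Context (R : realType) (d : nat).

Let coors (i : 'I_d) (x : 'rV[R]_d) : R := x ord0 i.

Let rV_set0 : g_sigma_preimage coors set0.
Proof. exact: sigma_algebra0. Qed.

Let rV_setC A : g_sigma_preimage coors A -> g_sigma_preimage coors (~` A).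
Proof. exact: sigma_algebraC. Qed.

Let rV_bigcup (A : (set 'rV[R]_d)^nat) :
  (forall i, g_sigma_preimage coors (A i)) ->
  g_sigma_preimage coors (\bigcup_i A i).
Proof. exact: sigma_algebra_bigcup. Qed.

HB.instance Definition _ := @isMeasurable.Build measure_rV_display
  'rV[R]_d (g_sigma_preimage coors) rV_set0 rV_setC rV_bigcup.

End measurable_rV.

Section euclidean.
Context (R : realType) (d : nat).
Implicit Types (u v x : 'rV[R]_d) (F : 'rV[R]_d -> R).

Definition dot u v : R := \sum_(i < d) u ord0 i * v ord0 i.

(* The library norm `|v| on matrices is the sup norm. *)
Definition norm2 v : R := Num.sqrt (dot v v).

Definition grad F x : 'rV[R]_d :=
  \row_(i < d) 'D_(delta_mx ord0 i : 'rV[R]_d) F x.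

Definition continuously_differentiable F : Prop :=
  (forall x, differentiable F x) /\ continuous (grad F).

Definition lipschitz_gradient F (L : R) : Prop :=
  forall x x', norm2 (grad F x' - grad F x) <= L * norm2 (x' - x).

Definition strongly_convex F (l : R) : Prop :=
  forall x x',
    F x' >= F x + dot (grad F x) (x' - x) + l / 2 * norm2 (x' - x) ^+ 2.

Definition unique_minimizer F x : Prop :=
  (forall y, F x <= F y) /\ (forall z, (forall y, F z <= F y) -> z = x).

End euclidean.

(* Euler's integral, which is the gamma function for a > 0. When 0 < d, the
   argument 1 + sigma - beta * l is positive: strong convexity and the Lipschitz
   gradient give l <= L, so beta / (1 + sigma) <= (L * (M_V + 2))^-1 forces
   beta * l <= (1 + sigma) / 2. *)
Definition Gamma (R : realType) (a : R) : R :=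
  \int[lebesgue_measure]_(t in `]0%R, +oo[) (t `^ (a - 1) * expR (- t)).

Section probability.
Context (R : realType) (dO : measure_display) (Omega : measurableType dO).
Variable Pr : probability Omega R.

Definition mutual_independence (I : choiceType) (D : set I)
    (G : I -> set (set Omega)) : Prop :=
  forall J : {fset I}, [set` J] `<=` D ->
  forall E : I -> set Omega, (forall t, t \in J -> G t (E t)) ->
  Pr (\bigcap_(t in [set` J]) E t) = (\prod_(t <- J) Pr (E t))%E.

Section random_vector.
Variable d : nat.
Implicit Types S Z : Omega -> 'rV[R]_d.

Definition mean S : 'rV[R]_d :=
  \row_(i < d) fine 'E_Pr[fun w => S w ord0 i]%E.

(* Extended-real valued: it is +oo when S is not square integrable, and
   otherwise every coordinate of S is integrable, so that [mean S] is the
   actual expectation. *)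
Definition vec_variance S : \bar R :=
  ('E_Pr[fun w => (norm2 (S w) ^+ 2)%R] - (norm2 (mean S) ^+ 2)%:E)%E.

(* r bounds the components and m their fourth moments; the value +oo stands for
   an unavailable bound, and at least one of the two must be available.
   The fourth moments are nonzero because the second ones are. *)
Definition direction_assumption (r m : \bar R) Z : Prop :=
  [/\ forall i : 'I_d, ('E_Pr[fun w => Z w ord0 i] = 0)%E,
      forall i j : 'I_d,
        ('E_Pr[fun w => (Z w ord0 i * Z w ord0 j)%R] = (i == j)%:R%:E)%E,
      forall i : 'I_d, {ae Pr, forall w, (`|Z w ord0 i|%:E <= r)%E},
      forall i : 'I_d, ('E_Pr[fun w => (Z w ord0 i ^+ 4)%R] <= m)%E
    & (r < +oo)%E \/ (m < +oo)%E].

End random_vector.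
End probability.

Definition D_zeta (R : realType) (d : nat) (r m : \bar R) : R :=
  fine (Order.min r (sqrte (1 + m * (d%:R^-1)%:E - (d%:R^-1)%:E)))%E.

Variant sgfd_choice :=
  | SingleSample | SharedDirection | NestedSamples | PairedSamples.

(* The k-th step of every choice draws from the seeds xi_{k,i,j} and
   zeta_{k,i}, with indices starting from 0; an index absent from the
   notation of a choice (e.g. j in xi_{k,i}) is 0. The distributional
   assumptions only concern the seeds that are actually drawn. *)
Section sgfd.
Context (R : realType) (d : nat) (dX : measure_display).
Variable Xi : measurableType dX.
Implicit Types (f : 'rV[R]_d -> Xi -> R) (c : sgfd_choice).

Definition objective (P : probability Xi R) f (x : 'rV[R]_d) : R :=
  \int[P]_u f x u.

Definition sgfd_step c f (n q : nat) (x : 'rV[R]_d) (a : R)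
    (xi : nat -> nat -> Xi) (zeta : nat -> 'rV[R]_d) : 'rV[R]_d :=
  match c with
  | SingleSample =>
      (f x (xi 0 0)%N - f (x + a *: zeta 0%N) (xi 0 0)%N) *: zeta 0%N
  | SharedDirection =>
      n%:R^-1 *: \sum_(i < n)
        (f x (xi i 0)%N - f (x + a *: zeta 0%N) (xi i 0)%N) *: zeta 0%N
  | NestedSamples =>
      n%:R^-1 *: \sum_(i < n)
        (q%:R^-1 * \sum_(j < q) (f x (xi i j) - f (x + a *: zeta i) (xi i j)))
          *: zeta i
  | PairedSamples =>
      n%:R^-1 *: \sum_(i < n)
        (f x (xi i 0)%N - f (x + a *: zeta i) (xi i 0)%N) *: zeta i
  end.

Definition uses_xi c (n q i j : nat) : bool :=
  match c with
  | SingleSample => (i == 0) && (j == 0)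
  | SharedDirection | PairedSamples => (i < n) && (j == 0)
  | NestedSamples => (i < n) && (j < q)
  end%N.

Definition uses_zeta c (n i : nat) : bool :=
  match c with
  | SingleSample | SharedDirection => i == 0
  | NestedSamples | PairedSamples => i < n
  end%N.

Definition seed_index : choiceType := (nat * nat * nat + nat * nat)%type.

Definition seeds c (n q : nat -> nat) : set seed_index :=
  [set t | match t with
           | inl (k, i, j) => (0 < k)%N && uses_xi c (n k) (q k) i j
           | inr (k, i) => (0 < k)%N && uses_zeta c (n k) i
           end].

Context (dO : measure_display) (Omega : measurableType dO).
Variable Pr : probability Omega R.
Implicit Types (xi : nat -> nat -> nat -> Omega -> Xi)
  (zeta : nat -> nat -> Omega -> 'rV[R]_d).

Definition seed_sigma xi zeta (t : seed_index) : set (set Omega) :=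
  match t with
  | inl (k, i, j) => preimage_set_system setT (xi k i j) measurable
  | inr (k, i) => preimage_set_system setT (zeta k i) measurable
  end.

Definition sgfd_sampling c (n q : nat -> nat) (P : probability Xi R)
    xi zeta : Prop :=
  [/\ forall k i j, seeds c n q (inl (k, i, j)) ->
        measurable_fun setT (xi k i j) /\
        (forall A, measurable A -> Pr (xi k i j @^-1` A) = P A),
      forall k i, seeds c n q (inr (k, i)) -> measurable_fun setT (zeta k i),
      forall k i k' i', seeds c n q (inr (k, i)) ->
        seeds c n q (inr (k', i')) -> forall A, measurable A ->
        Pr (zeta k i @^-1` A) = Pr (zeta k' i' @^-1` A)
    & mutual_independence Pr (seeds c n q) (seed_sigma xi zeta)].

(* s(x, xi_k, alpha_k, zeta_k) as a random vector, for a fixed point x. *)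
Definition sgfd_random_step c f (n q : nat -> nat) (alpha : nat -> R)
    xi zeta (k : nat) (x : 'rV[R]_d) (w : Omega) : 'rV[R]_d :=
  sgfd_step c f (n k) (q k) x (alpha k)
    (fun i j => xi k i j w) (fun i => zeta k i w).

Definition sgfd_run c f (n q : nat -> nat) (alpha : nat -> R) xi zeta
    (x1 : 'rV[R]_d) (x : nat -> Omega -> 'rV[R]_d) : Prop :=
  (forall w, x 1%N w = x1) /\
  (forall k w, (0 < k)%N -> x k.+1 w =
     x k w + sgfd_random_step c f n q alpha xi zeta k (x k w) w).

(* The variance over the k-th seeds is evaluated at the realized iterate,
   which is held fixed, and the bound holds for almost every realization. *)
Definition variance_assumption c f (n q : nat -> nat) (alpha : nat -> R)
    xi zeta (x : nat -> Omega -> 'rV[R]_d) (F : 'rV[R]_d -> R)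
    (M MV : R) : Prop :=
  forall k, (0 < k)%N -> {ae Pr, forall w,
    (vec_variance Pr (sgfd_random_step c f n q alpha xi zeta k (x k w)) <=
     (alpha k ^+ 2 * M + alpha k ^+ 2 * MV * norm2 (grad F (x k w)) ^+ 2)%:E)%E}.

End sgfd.

(* Main.v *)
Require Import Defs.
From HB Require Import structures.
From mathcomp Require Import all_boot all_order all_algebra finmap.
From mathcomp Require Import all_classical all_reals all_analysis.
From mathcomp Require Import measurable_realfun.
From mathcomp Require Import ring lra.

Set Implicit Arguments.
Unset Strict Implicit.
Unset Printing Implicit Defensive.

Import Order.TTheory GRing.Theory Num.Theory.
Import numFieldNormedType.Exports.

Local Open Scope classical_set_scope.
Local Open Scope ring_scope.

(** Each stepsize yields a contraction with an additive error of second order.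
    Let g be the gradient of F at the iterate x_k, a = alpha_k, and Fmin the
    minimum of F.

    The iterate x_k depends on the seeds of the steps before k only, so it is
    independent of those of step k: E[F(x_{k+1})] is obtained by averaging over
    the seeds of step k with x_k held fixed, and then over x_k
    ([gap_freeze], which rests on [join_independent] and Tonelli's theorem).

    For a fixed x_k, averaging over the samples xi with the directions held
    fixed replaces f by F in the step ([mean_step_objective]). Expanding F to
    first order, E[s] = - a g + e with |e| = O(a^2): the covariance of a
    direction is the identity, and the remainder is controlled by its fourth
    moments ([direction_mean], [fourth_moment_bound]). The descent lemma, the
    variance assumption and Young's inequality then give ([one_step])

      E[F(x_k + s)] - Fmin <= F(x_k) - Fmin - a (1/2 - eps) |g|^2 + O(a^2),

    where the term in |E[s]|^2 and the part of the variance proportional to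
    |g|^2 are absorbed thanks to alpha_1 <= 1 / (L M_G). As
    |g|^2 >= 2 l (F(x_k) - Fmin) by strong convexity, the expected gap phi_k
    satisfies phi_{k+1} <= (1 - lambda alpha_k) phi_k + C alpha_k^2 with
    lambda = l (1 - 2 eps). Since beta l > 1, eps can be chosen such that
    beta lambda > 1, and then phi_k <= nu / (k + 1 + sigma) for some nu
    ([harmonic_stepsize_decay], [expected_gap_decay]).

    This gives both conclusions. The constants C_A and C_B may depend on all
    the data but k: the first term of the bound is nonnegative, since Gamma
    is, so C_A = 1 will do, and the second one dominates nu / (k + 1 + sigma)
    once C_B is large, provided that M_d > 0, which holds because D_zeta >= 1
    ([D_zeta_ge1]). *)

(** * Euclidean geometry and smooth strongly convex functions *)

Section euclidean_facts.
Context (R : realType) (d : nat).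
Implicit Types (u v x y : 'rV[R]_d) (F : 'rV[R]_d -> R).

Lemma dotvv_ge0 u : 0 <= dot u u.
Proof. by apply: sumr_ge0 => i _; rewrite -expr2 sqr_ge0. Qed.

Lemma norm2_ge0 u : 0 <= norm2 u.
Proof. exact: sqrtr_ge0. Qed.

Lemma norm2_sqr u : norm2 u ^+ 2 = dot u u.
Proof. by rewrite sqr_sqrtr ?dotvv_ge0. Qed.

Lemma dotDr u v w : dot u (v + w) = dot u v + dot u w.
Proof. by rewrite -big_split; apply: eq_bigr => i _; rewrite mxE mulrDr. Qed.

Lemma dotDl u v w : dot (u + v) w = dot u w + dot v w.
Proof. by rewrite -big_split; apply: eq_bigr => i _; rewrite mxE mulrDl. Qed.

Lemma dotZr a u v : dot u (a *: v) = a * dot u v.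
Proof. by rewrite mulr_sumr; apply: eq_bigr => i _; rewrite mxE mulrCA. Qed.

Lemma dotZl a u v : dot (a *: u) v = a * dot u v.
Proof. by rewrite mulr_sumr; apply: eq_bigr => i _; rewrite mxE mulrA. Qed.

Lemma norm2Z a u : norm2 (a *: u) = `|a| * norm2 u.
Proof.
by rewrite /norm2 dotZl dotZr mulrA -expr2 sqrtrM ?sqr_ge0// sqrtr_sqr.
Qed.

(** Young's inequality, coordinate by coordinate. *)
Lemma dot_young a u v : 0 < a ->
  dot u v <= a * dot u u + (4 * a)^-1 * dot v v.
Proof.
move=> a0; rewrite !mulr_sumr -big_split; apply: ler_sum => i _ /=.
set s := u _ _; set t := v _ _.
rewrite -subr_ge0 (_ : _ - _ = a * (s - t / (2 * a)) ^+ 2).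
  by rewrite mulr_ge0 ?sqr_ge0 ?ltW.
by field; rewrite gt_eqF.
Qed.

Lemma dot_add_sqr_le u v : dot (u + v) (u + v) <= 2 * dot u u + 2 * dot v v.
Proof.
rewrite !mulr_sumr -big_split; apply: ler_sum => i _ /=; rewrite !mxE.
set s := u _ _; set t := v _ _.
rewrite -subr_ge0 (_ : _ - _ = (s - t) ^+ 2) ?sqr_ge0//.
by ring.
Qed.

Lemma derive_dot_grad F x v : differentiable F x ->
  'D_v F x = dot (grad F x) v.
Proof.
move=> dF; rewrite deriveE// {1}(row_sum_delta v) linear_sum.
apply: eq_bigr => i _; rewrite linearZ /= mxE deriveE//.
by rewrite mulrC.
Qed.

Lemma is_derive_line F x v (t : R) : (forall y, differentiable F y) ->
  is_derive t (1 : R) (fun s : R => F (x + s *: v))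
    (dot (grad F (x + t *: v)) v).
Proof.
move=> dF.
have dl : is_diff t (cst x + *:%R^~ v) (0 + *:%R^~ v).
  exact: (is_diffD (is_diff_cst x t) (is_diff_scalel t v)).
have dF' : is_diff ((cst x + *:%R^~ v) t) F ('d F (x + t *: v)).
  by apply: DiffDef => //; exact: dF.
have dc : is_diff t (F \o (cst x + *:%R^~ v))
  ('d F (x + t *: v) \o (0 + *:%R^~ v)) by exact: is_diff_comp.
rewrite (_ : (fun s => _) = F \o (cst x + *:%R^~ v)); last by apply/funext.
have df : differentiable (F \o (cst x + *:%R^~ v)) t by case: dc.
apply: DeriveDef; first exact/derivable1_diffP.
rewrite deriveE// (@diff_val _ _ _ _ _ _ _ dc) /= -derive_dot_grad// deriveE//.
by rewrite [(_ + _) 1]/= add0r scale1r.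
Qed.

(** The descent lemma. *)
Lemma lipschitz_gradient_upper F (L : R) x v :
  (forall y, differentiable F y) -> 0 < L -> lipschitz_gradient F L ->
  F (x + v) <= F x + dot (grad F x) v + L / 2 * dot v v.
Proof.
move=> dF L0 lipF; set c := dot (grad F x) v; set s := dot v v.
pose psi := (fun t : R => F (x + t *: v)) -
            (c *: (id : R -> R) + (L / 2 * s) *: ((id : R -> R) ^+ 2)).
have dpsi (t : R) : is_derive t 1 psi
    (dot (grad F (x + t *: v)) v - (c + L * s * t)).
  have dline := is_derive_line x v t dF.
  have did := is_derive_id t (1 : R).
  have dq := is_deriveD (is_deriveZ c did)
    (is_deriveZ (L / 2 * s) (is_deriveX 2 did)).
  apply: (is_derive_eq (is_deriveB dline dq)).
  by rewrite /GRing.scale/=; lra.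
have cpsi : {within `[0, 1], continuous psi}.
  apply: continuous_subspaceT => t; apply: differentiable_continuous.
  by apply/derivable1_diffP; have [] := dpsi t.
have [t] := MVT ltr01 (fun t _ => dpsi t) cpsi.
rewrite in_itv/= => /andP[t0 _].
have -> : psi 0 = F x.
  by rewrite /psi !fctE scale0r addr0 expr0n/= !scaler0 addr0 subr0.
have -> : psi 1 = F (x + v) - (c + L / 2 * s).
  by rewrite /psi !fctE scale1r expr1n /GRing.scale/= !mulr1.
rewrite subr0 mulr1.
suff : dot (grad F (x + t *: v)) v <= c + L * s * t by lra.
(* Young's inequality balanced so that both terms equal L t |v|^2 / 2 *)
have := @dot_young (2 * L * t)^-1 (grad F (x + t *: v) - grad F x) v.
have Lt0 : 0 < 2 * L * t by rewrite !mulr_gt0.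
rewrite invr_gt0 => /(_ Lt0).
rewrite dotDl -[- grad F x]scaleN1r dotZl -/c -/s scaleN1r.
have := lipF x (x + t *: v).
rewrite [x + _]addrC addrK norm2Z (gtr0_norm t0) => lip.
have {lip} : dot (grad F (t *: v + x) - grad F x) (grad F (t *: v + x) - grad F x)
    <= (L * t) ^+ 2 * s.
  rewrite -norm2_sqr /s -norm2_sqr -exprMn ler_sqr ?nnegrE ?norm2_ge0//.
    by rewrite -mulrA.
  by rewrite !mulr_ge0 ?norm2_ge0 ?ltW.
set D := dot (_ - _) _ => DL.
have : (2 * L * t)^-1 * D <= L * t * s / 2.
  rewrite mulrC ler_pdivrMr//; apply: (le_trans DL); rewrite le_eqVlt.
  by apply/orP; left; apply/eqP; field.
rewrite (_ : (4 * (2 * L * t)^-1)^-1 = L * t / 2); first by lra.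
by field; rewrite !gt_eqF.
Qed.

(** The Polyak-Lojasiewicz inequality. *)
Lemma strongly_convex_gradient_lower F (l : R) x y : 0 < l ->
  strongly_convex F l -> 2 * l * (F x - F y) <= dot (grad F x) (grad F x).
Proof.
move=> l0 /(_ x y); rewrite norm2_sqr.
set g := grad F x; set v := y - x => Fy.
have := @dot_young (2 * l)^-1 (- 1 *: g) v.
rewrite invr_gt0 mulr_gt0// => /(_ isT).
rewrite !dotZl dotZr (_ : (4 * (2 * l)^-1)^-1 = l / 2); last first.
  by field; rewrite gt_eqF.
move=> gv; have : F x - F y <= (2 * l)^-1 * dot g g by lra.
by rewrite mulrC ler_pdivlMr ?mulr_gt0// mulrC.
Qed.

End euclidean_facts.

(** * Decay of the recursion *)

(** Stepsizes beta / (k + sigma) turn the contraction factor 1 - lambda alpha_k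
    with beta lambda > 1 and an error of order alpha_k ^ 2 into decay of order
    1 / k. *)
Lemma harmonic_stepsize_decay (R : realType) (beta sigma lam K : R)
    (phi : nat -> R) : 0 < beta -> 0 < sigma -> 1 < beta * lam -> 0 <= K ->
  (forall k, 0 <= phi k) ->
  (forall k, (0 < k)%N -> phi k.+1 <=
     (1 - beta / (k%:R + sigma) * lam) * phi k +
     K * (beta / (k%:R + sigma)) ^+ 2) ->
  exists2 nu, 0 <= nu & forall k, (0 < k)%N -> phi k <= nu / (k%:R + 1 + sigma).
Proof.
move=> b0 s0 bl K0 phi0 phiS.
pose K' := K * beta ^+ 2.
have K'0 : 0 <= K' by rewrite mulr_ge0 ?sqr_ge0.
pose mu := phi 1%N * (1 + sigma) + 2 * K' + K' / (beta * lam - 1).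
have bl0 : 0 < beta * lam - 1 by lra.
have p1 : 0 <= phi 1%N * (1 + sigma) by rewrite mulr_ge0 ?phi0 ?addr_ge0 ?ltW.
have q0 : 0 <= K' / (beta * lam - 1) by rewrite divr_ge0// ltW.
have mu0 : 0 <= mu by rewrite /mu; lra.
have mu1 : K' <= mu * (beta * lam - 1).
  rewrite -ler_pdivrMr// /mu.
  by lra.
(* the shift from k to k + 1 in the denominator costs a factor 2 *)
suff H k : (0 < k)%N -> phi k <= mu / (k%:R + sigma).
  exists (2 * mu); first by rewrite mulr_ge0.
  move=> k k0; apply: (le_trans (H k k0)).
  have k1 : 1 <= k%:R :> R by rewrite ler1n.
  rewrite ler_pdivlMr; last by lra.
  rewrite mulrAC ler_pdivrMr; last by lra.
  by nra.
case: k => // k _; elim: k => [|k ih].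
  rewrite ler_pdivlMr; last by lra.
  by rewrite /mu; nra.
apply: (le_trans (phiS k.+1 isT)); move: ih (phi0 k.+1).
rewrite -[k.+2%:R]natr1.
have t1 : 1 <= k.+1%:R + sigma.
  by have : 1 <= k.+1%:R :> R; [rewrite ler1n | lra].
rewrite -[_ + 1 + sigma]addrA [1 + sigma]addrC addrA.
set t := k.+1%:R + sigma in t1 *; set p := phi _ => pt p0.
have t0 : 0 < t by lra.
have -> : (1 - beta / t * lam) * p + K * (beta / t) ^+ 2 =
   ((1 - beta / t * lam) * p * t ^+ 2 + K') / t ^+ 2.
  by rewrite /K'; field; rewrite gt_eqF.
rewrite ler_pdivrMr ?exprn_gt0//.
rewrite [leRHS]mulrAC ler_pdivlMr; last by lra.
have -> : (1 - beta / t * lam) * p * t ^+ 2 = (t - beta * lam) * (p * t).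
  by field; rewrite gt_eqF.
have : p * t <= mu by rewrite -ler_pdivlMr.
have : 0 <= p * t by rewrite mulr_ge0// ltW.
have mu2 : 2 * K' <= mu by rewrite /mu; lra.
set b := beta * lam in bl bl0 mu1 *; move: (p * t) => P P0 Pmu.
have tt : t ^+ 2 = t * t by rewrite expr2.
(* for t <= b the contraction factor 1 - b / t is not positive *)
have [tb|tb] := leP t b.
  have h1 : (t - b) * P <= 0 by nra.
  have h2 : ((t - b) * P + K') * (t + 1) <= K' * (2 * t) by nra.
  apply: (le_trans h2); rewrite tt.
  have h3 : 2 * K' * t <= mu * t by rewrite ler_wpM2r// ltW.
  have : mu * t * 1 <= mu * t * t by rewrite ler_wpM2l// mulr_ge0// ltW.
  by lra.
have : (t - b) * P <= (t - b) * mu by rewrite ler_wpM2l//; lra.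
have : (t - b) * mu + K' <= (t - 1) * mu by lra.
rewrite tt => h1 h2.
have : (t - b) * P + K' <= (t - 1) * mu by lra.
move=> h3.
have h4 : ((t - b) * P + K') * (t + 1) <= (t - 1) * mu * (t + 1).
  by apply: ler_wpM2r => //; lra.
apply: (le_trans h4); nra.
Qed.

(** * Independence of generated sigma-algebras *)

Section independent_pair.
Context (R : realType) (dO d1 d2 : measure_display) (Omega : measurableType dO)
  (T1 : measurableType d1) (T2 : measurableType d2) (Pr : probability Omega R).
Variables (X : Omega -> T1) (Y : Omega -> T2).
Hypotheses (mX : measurable_fun setT X) (mY : measurable_fun setT Y).
Hypothesis indepXY : forall A B, measurable A -> measurable B ->
  Pr (X @^-1` A `&` Y @^-1` B) = (Pr (X @^-1` A) * Pr (Y @^-1` B))%E.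

Let mXY : measurable_fun setT (fun w => (X w, Y w)).
Proof. exact: measurable_fun_pair. Qed.
Let X' : {mfun Omega >-> T1} := mfun_Sub (mem_set mX).
Let Y' : {mfun Omega >-> T2} := mfun_Sub (mem_set mY).
Let Z' : {mfun Omega >-> (T1 * T2)%type} := mfun_Sub (mem_set mXY).

Let joint_law (A : set (T1 * T2)) : measurable A ->
  (distribution Pr X' \x distribution Pr Y')%E A = distribution Pr Z' A.
Proof.
by move=> mA; apply: product_measure_unique => // B C mB mC; exact: indepXY.
Qed.

(** The joint law of independent random elements is the product of their laws,
    so one of them can be held fixed while integrating over the other. *)
Lemma ge0_integral_independent (h : T1 * T2 -> \bar R) :
  measurable_fun setT h -> (forall z, 0 <= h z)%E ->
  (\int[Pr]_w h (X w, Y w) = \int[Pr]_w \int[Pr]_w' h (X w, Y w'))%E.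
Proof.
move=> mh h0.
rewrite -[LHS](@ge0_integral_distribution _ _ _ _ _ Pr Z')//.
rewrite -(eq_measure_integral _ (fun A mA _ => joint_law mA)).
rewrite fubini_tonelli1// ge0_integral_distribution//; first last.
- by move=> x; apply: integral_ge0.
- exact: measurable_fun_fubini_tonelli_F.
apply: eq_integral => w _; rewrite /= /fubini_F.
by rewrite ge0_integral_distribution//; exact: measurableT_comp.
Qed.

Lemma integral_independent (h : T1 * T2 -> \bar R) :
  measurable_fun setT h ->
  Pr.-integrable setT (fun w => h (X w, Y w)) ->
  (forall x, Pr.-integrable setT (fun w' => h (x, Y w'))) ->
  (\int[Pr]_w h (X w, Y w) = \int[Pr]_w \int[Pr]_w' h (X w, Y w'))%E.
Proof.
move=> mh ih ih2.
have iZ : (distribution Pr X' \x distribution Pr Y')%E.-integrable setT h.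
  apply/integrableP; split => //.
  rewrite (eq_measure_integral _ (fun A mA _ => joint_law mA)).
  rewrite ge0_integral_distribution//; last exact: measurableT_comp.
  by case/integrableP: ih.
rewrite -[LHS](@integral_distribution _ _ _ _ _ Pr Z')//.
rewrite -(eq_measure_integral _ (fun A mA _ => joint_law mA)).
rewrite -integral12_prod_meas1//.
have E x : fubini_F (distribution Pr Y') h x = (\int[Pr]_w' h (x, Y w'))%E.
  have mhx : measurable_fun setT (fun y => h (x, y)).
    exact: (@measurable_fun_pair2 _ _ _ _ _ _ h x mh).
  by rewrite /fubini_F (@integral_distribution _ _ _ _ _ Pr Y')//; exact: ih2.
rewrite (@integral_distribution _ _ _ _ _ Pr X')//.
- by apply: eq_integral => w _; exact: E.
- exact: (measurable_fubini_F iZ).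
have := integrable_fubini_F iZ => /integrableP[mF iF].
apply/integrableP; split; first exact: measurableT_comp.
move: iF; rewrite ge0_integral_distribution//; exact: measurableT_comp.
Qed.

End independent_pair.

Section grouping.
Context (R : realType) (dO : measure_display) (Omega : measurableType dO).
Variable Pr : probability Omega R.
Context (I : choiceType) (D : set I) (G : I -> set (set Omega)).
Hypothesis Gsigma : forall t, D t -> sigma_algebra setT (G t).
Hypothesis Gmeas : forall t, D t -> G t `<=` measurable.
Hypothesis indepG : mutual_independence Pr D G.

(** Finite intersections of events taken from the sigma-algebras with index
    in A: a pi-system which generates their join. *)
Definition cylinders (A : set I) : set (set Omega) :=
  [set U | exists J : {fset I}, exists E : I -> set Omega,
    [/\ [set` J] `<=` A, forall t, t \in J -> G t (E t) &
        U = \bigcap_(t in [set` J]) E t]].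

Let Gint t U V : D t -> G t U -> G t V -> G t (U `&` V).
Proof.
move=> Dt GU GV.
have [_ GC GB] := Gsigma Dt.
rewrite -[U `&` V]setCK setCI -bigcup2E -setTD; apply: (GC); apply: GB.
have G0 : G t set0 by case: (Gsigma Dt).
move=> [|[|n]] //=; rewrite /bigcup2/=.
- by rewrite -setTD; exact: GC.
- by rewrite -setTD; exact: GC.
Qed.

Let GT t : D t -> G t setT.
Proof. by move=> /Gsigma[G0 GC _]; rewrite -[setT]setD0; exact: GC. Qed.

Lemma cylinders_setT (A : set I) : cylinders A setT.
Proof.
exists fset0, (fun=> setT); split => //.
by apply/esym; rewrite -subTset => w _ t /=.
Qed.

(* A common family of events on the union of two index sets, padded with the
   whole space outside of each of them. *)
Let cylinders_pad (J K : {fset I}) (E H : I -> set Omega) :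
  (\bigcap_(t in [set` J]) E t) `&` (\bigcap_(t in [set` K]) H t) =
  \bigcap_(t in [set` (J `|` K)%fset])
    ((if t \in J then E t else setT) `&` (if t \in K then H t else setT)).
Proof.
apply/seteqP; split => w.
  move=> [wE wH] t /= _; split.
    by case: ifPn => // tJ; exact: wE.
  by case: ifPn => // tK; exact: wH.
move=> wEH; split => t /= tJ.
  by have := wEH t; rewrite /= inE tJ /= => /(_ isT)[].
by have := wEH t; rewrite /= inE tJ orbT => /(_ isT)[].
Qed.

Lemma cylinders_setI_closed (A : set I) : A `<=` D ->
  setI_closed (cylinders A).
Proof.
move=> AD _ _ [J [E [JA GE ->]]] [K [H [KA GH ->]]].
exists (J `|` K)%fset, (fun t =>
  (if t \in J then E t else setT) `&` (if t \in K then H t else setT)).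
split; last exact: cylinders_pad.
  by move=> t /=; rewrite inE => /orP[/JA|/KA].
move=> t; rewrite inE => tJK.
have Dt : D t by move: tJK => /orP[/JA/AD|/KA/AD].
by apply: Gint => //; case: ifPn => // *; [exact: GE|exact: GT|exact: GH|exact: GT].
Qed.

Lemma cylinders_measurable (A : set I) : A `<=` D ->
  cylinders A `<=` measurable.
Proof.
move=> AD _ [J [E [JA GE ->]]].
apply: fin_bigcap_measurable => // t tJ.
by apply: (Gmeas (t := t)); [exact/AD/JA|exact: GE].
Qed.

Lemma cylinders_generate (A : set I) : A `<=` D ->
  <<s \bigcup_(t in A) G t >> `<=` <<s cylinders A >>.
Proof.
move=> AD; apply: sub_sigma_algebra2 => U [t At GU].
exists [fset t]%fset, (fun=> U); split.
- by move=> s /=; rewrite inE => /eqP ->.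
- by move=> s; rewrite inE => /eqP ->.
- by apply/seteqP; split => w /= wU; [move=> s /= _|apply: (wU t) => /=; rewrite inE].
Qed.

Lemma cylinders_independent (A B : set I) : A `<=` D -> B `<=` D ->
  A `&` B = set0 -> forall U V, cylinders A U -> cylinders B V ->
  Pr (U `&` V) = (Pr U * Pr V)%E.
Proof.
move=> AD BD AB0 _ _ [J [E [JA GE ->]]] [K [H [KA GH ->]]].
have disj t : t \in J -> t \notin K.
  move=> tJ; apply/negP => tK.
  have : (A `&` B) t by split; [exact: JA|exact: KA].
  by rewrite AB0.
rewrite cylinders_pad indepG; last 2 first.
- by move=> t /=; rewrite inE => /orP[/JA/AD|/KA/BD].
- move=> t; rewrite inE => tJK.
  have Dt : D t by move: tJK => /orP[/JA/AD|/KA/BD].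
  by apply: Gint => //; case: ifPn => // *; [exact: GE|exact: GT|exact: GH|exact: GT].
rewrite indepG//; last by move=> t /JA/AD.
rewrite indepG//; last by move=> t /KA/BD.
transitivity (\prod_(t <- (J `|` K)%fset)
    (Pr (if t \in J then E t else setT) * Pr (if t \in K then H t else setT)))%E.
  rewrite !big_seq; apply: eq_bigr => t _; case: ifPn => tJ; last first.
    by rewrite setTI probability_setT mul1e.
  by rewrite (negbTE (disj _ tJ)) setIT probability_setT mule1.
have restrict (L : {fset I}) (V : I -> set Omega) : (L `<=` J `|` K)%fset ->
    (\prod_(t <- (J `|` K)%fset) Pr (if t \in L then V t else setT) =
     \prod_(t <- L) Pr (V t))%E.
  move=> LJK; rewrite -(big_fset_incl _ LJK) => [|t _ /negbTE ->]; last first.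
    exact: probability_setT.
  by rewrite !big_seq; apply: eq_bigr => t ->.
by rewrite big_split/= !restrict ?fsubsetUl ?fsubsetUr.
Qed.

(** Disjoint subfamilies of independent sigma-algebras have independent joins.
    Two applications of the uniqueness of measures on pi-systems, one in each
    event. *)
Lemma join_independent (A B : set I) : A `<=` D -> B `<=` D ->
  A `&` B = set0 -> forall U V,
  <<s \bigcup_(t in A) G t >> U -> <<s \bigcup_(t in B) G t >> V ->
  Pr (U `&` V) = (Pr U * Pr V)%E.
Proof.
move=> AD BD AB0.
have smeas (C : set I) U : C `<=` D -> <<s cylinders C >> U -> measurable U.
  move=> CD; apply: smallest_sub; first exact: sigma_algebra_measurable.
  exact: cylinders_measurable.
have uniq (C : set I) (CD : C `<=` D) (V : set Omega) (mV : measurable V) :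
  (forall U, cylinders C U -> Pr (U `&` V) = (Pr U * Pr V)%E) ->
  forall U, <<s cylinders C >> U -> Pr (U `&` V) = (Pr U * Pr V)%E.
  move=> CV U sU.
  pose r : {nonneg R} := NngNum (fine_ge0 (measure_ge0 Pr V)).
  have rE : r%:num%:E = Pr V by rewrite /= fineK// fin_num_measure.
  have cov : \bigcup_(k : nat) [set: Omega] = setT.
    by rewrite -subTset => w _; exists 0%N.
  have /= H := @g_sigma_algebra_measure_unique _ _ _ (cylinders C)
    (cylinders_measurable CD) (fun=> setT) (fun=> cylinders_setT C) cov
    (mrestr Pr mV) (mscale r Pr) (cylinders_setI_closed CD).
  rewrite /mrestr /mscale rE in H.
  rewrite [RHS]muleC; apply: H => //.
    by move=> W CW; rewrite muleC; exact: CV.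
  move=> _; apply: (le_lt_trans (probability_le1 _ _)); last exact: ltry.
  exact: measurableI.
move=> U V sU sV.
have {}sU := cylinders_generate AD sU.
have {}sV := cylinders_generate BD sV.
apply: (uniq A) => //; first exact: smeas sV.
move=> W CW; rewrite setIC muleC; apply: (uniq B) => //.
  exact: cylinders_measurable CW.
by move=> X CX; rewrite setIC muleC; exact: (cylinders_independent AD BD).
Qed.

End grouping.

Section freezing.
Context (R : realType) (dO : measure_display) (Omega : measurableType dO).
Variable Pr : probability Omega R.
Context (I : choiceType) (D : set I) (G : I -> set (set Omega)).
Hypothesis Gsigma : forall t, D t -> sigma_algebra setT (G t).
Hypothesis Gmeas : forall t, D t -> G t `<=` measurable.
Hypothesis indepG : mutual_independence Pr D G.

(** The sample space with the sigma-algebra generated by the subfamily A. *)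
Definition join_space (G' : I -> set (set Omega)) (A : set I) :=
  g_sigma_algebraType (\bigcup_(t in A) G' t).

HB.instance Definition _ G' A := Measurable.on (join_space G' A).

Lemma measurable_id_join (A : set I) : A `<=` D ->
  measurable_fun setT (id : Omega -> join_space G A).
Proof.
move=> AD; apply: (@measurability _ _ Omega (join_space G A) setT id
  (\bigcup_(t in A) G t)) => [//|_ [U [t At GU] <-]].
by rewrite setTI preimage_id; exact: (Gmeas (AD _ At)).
Qed.

Lemma measurable_join_in d (T : measurableType d) (A : set I) (g : Omega -> T) t :
  A t -> preimage_set_system setT g measurable `<=` G t ->
  measurable_fun setT (g : join_space G A -> T).
Proof.
move=> At gG _ U mU; apply: sub_sigma_algebra; exists t => //.
by apply: gG; exists U.
Qed.

Lemma measurable_join_sub d (T : measurableType d) (A B : set I) (g : Omega -> T) :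
  A `<=` B -> measurable_fun setT (g : join_space G A -> T) ->
  measurable_fun setT (g : join_space G B -> T).
Proof.
move=> AB mg _ U mU; apply: (sub_sigma_algebra2 (M := \bigcup_(t in A) G t)).
  exact: bigcup_subset.
exact: mg.
Qed.

Section disjoint_joins.
Variables A B : set I.
Hypotheses (AD : A `<=` D) (BD : B `<=` D) (AB0 : A `&` B = set0).

Let indepAB (U : set (join_space G A)) (V : set (join_space G B)) :
  measurable U -> measurable V ->
  Pr ((id : Omega -> join_space G A) @^-1` U `&`
      (id : Omega -> join_space G B) @^-1` V) =
  (Pr ((id : Omega -> join_space G A) @^-1` U) *
   Pr ((id : Omega -> join_space G B) @^-1` V))%E.
Proof. exact: (join_independent Gsigma Gmeas indepG AD BD AB0). Qed.

(** Any function of the two joins is a function on the product of the two join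
    spaces, evaluated on the diagonal; the two arguments are independent, each
    being the identity seen as a random element of a join space. *)
Lemma ge0_integral_freeze (h : join_space G A * join_space G B -> \bar R) :
  measurable_fun setT h -> (forall z, 0 <= h z)%E ->
  (\int[Pr]_w h (w, w) = \int[Pr]_w \int[Pr]_w' h (w, w'))%E.
Proof.
exact: (ge0_integral_independent (measurable_id_join AD) (measurable_id_join BD)).
Qed.

Lemma integral_freeze (h : join_space G A * join_space G B -> \bar R) :
  measurable_fun setT h ->
  Pr.-integrable setT (fun w => h (w, w)) ->
  (forall w, Pr.-integrable setT (fun w' => h (w, w'))) ->
  (\int[Pr]_w h (w, w) = \int[Pr]_w \int[Pr]_w' h (w, w'))%E.
Proof.
exact: (integral_independent (measurable_id_join AD) (measurable_id_join BD)).
Qed.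

End disjoint_joins.
End freezing.

(** * Measurability of the objective and of the steps *)

Section measurable_vectors.
Context (R : realType) (d : nat) (dT : measure_display) (T : measurableType dT).
Implicit Types (u v : T -> 'rV[R]_d).

Lemma measurable_coord (j : 'I_d) :
  measurable_fun setT (fun v : 'rV[R]_d => v ord0 j).
Proof.
move=> _ B mB; rewrite setTI; apply: sub_sigma_algebra.
rewrite -bigcup_seq /=.
exists j => //=; first by rewrite mem_index_enum.
by exists B => //; rewrite setTI.
Qed.

Lemma measurable_rVP v : measurable_fun setT v <->
  forall j, measurable_fun setT (fun t => v t ord0 j).
Proof.
split=> [mv j|mv].
  exact: (measurableT_comp (measurable_coord j) mv).
suff sub : measurable `<=` image_set_system setT v measurable by move=> _; exact: sub.
apply: smallest_sub.
  exact/sigma_algebra_image/sigma_algebra_measurable.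
rewrite -bigcup_seq => _ [j _ [B mB <-]].
by rewrite /image_set_system/= setTI; exact: mv.
Qed.

Lemma measurable_rVD u v : measurable_fun setT u -> measurable_fun setT v ->
  measurable_fun setT (fun t => u t + v t).
Proof.
move=> /measurable_rVP mu /measurable_rVP mv; apply/measurable_rVP => j.
under eq_fun do rewrite mxE.
exact: measurable_funD.
Qed.

Lemma measurable_rVZ (a : T -> R) v : measurable_fun setT a ->
  measurable_fun setT v -> measurable_fun setT (fun t => a t *: v t).
Proof.
move=> ma /measurable_rVP mv; apply/measurable_rVP => j.
under eq_fun do rewrite mxE.
exact: measurable_funM.
Qed.

Lemma measurable_rV_sum n (v : 'I_n -> T -> 'rV[R]_d) :
  (forall i, measurable_fun setT (v i)) ->
  measurable_fun setT (fun t => \sum_(i < n) v i t).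
Proof.
move=> mv; apply/measurable_rVP => j.
under eq_fun do rewrite summxE.
by apply: measurable_sum => i; have /measurable_rVP := mv i; exact.
Qed.

Lemma measurable_dot u v : measurable_fun setT u -> measurable_fun setT v ->
  measurable_fun setT (fun t => dot (u t) (v t)).
Proof.
move=> /measurable_rVP mu /measurable_rVP mv.
by apply: measurable_sum => i; exact: measurable_funM.
Qed.

End measurable_vectors.

Section measurable_objective.
Context (R : realType) (d : nat) (dX : measure_display)
  (Xi : measurableType dX) (P : probability Xi R) (f : 'rV[R]_d -> Xi -> R).
Hypothesis f_measurable :
  measurable_fun setT (fun p : 'rV[R]_d * Xi => f p.1 p.2).

Lemma measurable_section x : measurable_fun setT (f x).
Proof. exact: (measurableT_comp f_measurable (pair1_measurable x)). Qed.

(** The objective is measurable by Fubini's theorem. *)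
Lemma measurable_objective :
  measurable_fun setT (objective P f).
Proof.
pose g (z : 'rV[R]_d * Xi) := (f z.1 z.2)%:E.
have mg : measurable_fun setT g by exact/measurable_EFinP.
apply: (measurableT_comp (@fine_measurable R setT measurableT)).
rewrite (_ : (fun x => _) = (fubini_F P g^\+ \- fubini_F P g^\-)%E); last first.
  apply/funext => x; rewrite integralE.
  by congr (_ - _)%E; apply: eq_integral => u _; rewrite ?funeposE ?funenegE.
apply: emeasurable_funB.
  apply: measurable_fun_fubini_tonelli_F => //; exact: measurable_funepos.
apply: measurable_fun_fubini_tonelli_F => //; exact: measurable_funeneg.
Qed.

(** The four choices at once: an average over pairs (i, j) of single-sample
    steps, in which the direction of the pair (i, j) is that of index tau i. *)
Lemma sgfd_stepE c (n q : nat) : (0 < n)%N -> (0 < q)%N ->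
  exists N Q : nat, exists tau : nat -> nat,
  [/\ (0 < N * Q)%N, forall i j, (i < N)%N -> (j < Q)%N -> uses_xi c n q i j,
      forall i, (i < N)%N -> uses_zeta c n (tau i) &
      forall (h : 'rV[R]_d -> Xi -> R) x a xi zeta,
        sgfd_step c h n q x a xi zeta =
        (N * Q)%:R^-1 *: \sum_(i < N) \sum_(j < Q)
          (h x (xi i j) - h (x + a *: zeta (tau i)) (xi i j)) *: zeta (tau i)].
Proof.
move=> n0 q0; case: c => /=.
- exists 1%N, 1%N, (fun=> 0%N); split => // [i j|h x a xi zeta].
    by case: i => //; case: j.
  by rewrite !big_ord1 invr1 scale1r.
- exists n, 1%N, (fun=> 0%N); rewrite muln1; split => // [i j -> |h x a xi zeta].
    by case: j.
  by congr (_ *: _); apply: eq_bigr => i _; rewrite big_ord1.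
- exists n, q, id; split => // [|i j -> ->//|h x a xi zeta].
    by rewrite muln_gt0 n0.
  rewrite natrM invfM -scalerA; congr (_ *: _).
  rewrite scaler_sumr; apply: eq_bigr => i _.
  by rewrite -scaler_suml scalerA.
- exists n, 1%N, id; rewrite muln1; split => // [i j -> |h x a xi zeta].
    by case: j.
  by congr (_ *: _); apply: eq_bigr => i _; rewrite big_ord1.
Qed.

Lemma measurable_sgfd_step c (n q : nat) a (dT : measure_display)
    (T : measurableType dT) (y : T -> 'rV[R]_d) (xi : T -> nat -> nat -> Xi)
    (zeta : T -> nat -> 'rV[R]_d) : (0 < n)%N -> (0 < q)%N ->
  measurable_fun setT y ->
  (forall i j, uses_xi c n q i j -> measurable_fun setT (fun t => xi t i j)) ->
  (forall i, uses_zeta c n i -> measurable_fun setT (fun t => zeta t i)) ->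
  measurable_fun setT (fun t => sgfd_step c f n q (y t) a (xi t) (zeta t)).
Proof.
move=> n0 q0 my mxi mzeta; have [N [Q [tau [_ NQ Ntau stepE]]]] := sgfd_stepE c n0 q0.
have mf (z : T -> 'rV[R]_d) (u : T -> Xi) : measurable_fun setT z ->
    measurable_fun setT u -> measurable_fun setT (fun t => f (z t) (u t)).
  by move=> mz mu; exact: (measurableT_comp f_measurable (measurable_fun_pair mz mu)).
under eq_fun do rewrite stepE.
apply: measurable_rVZ => //; apply: measurable_rV_sum => i.
apply: measurable_rV_sum => j.
have /mxi mx := NQ i j (ltn_ord i) (ltn_ord j).
have /mzeta mz := Ntau i (ltn_ord i).
apply: measurable_rVZ => //; apply: measurable_funB; first exact: mf.
by apply: mf => //; apply: measurable_rVD => //; exact: measurable_rVZ.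
Qed.

End measurable_objective.

(** * Real-valued integrals and moments of the directions *)

Section real_integrals.
Context (R : realType) (dT : measure_display) (T : measurableType dT).
Variable mu : probability T R.
Implicit Types (X Y : T -> R).

Lemma integrable_dominated X Y : measurable_fun setT X ->
  mu.-integrable setT (EFin \o Y) -> (forall w, `|X w| <= Y w) ->
  mu.-integrable setT (EFin \o X).
Proof.
move=> mX iY XY; apply: (le_integrable _ _ _ iY) => //.
  exact/measurable_EFinP.
by move=> w _ /=; rewrite lee_fin (le_trans (XY w))// ler_norm.
Qed.

Lemma integrable_EFinD X Y : mu.-integrable setT (EFin \o X) ->
  mu.-integrable setT (EFin \o Y) ->
  mu.-integrable setT (EFin \o (fun w => X w + Y w)).
Proof. by move=> iX iY; apply: (integrableD _ iX iY). Qed.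

Lemma integrable_EFinZ a X : mu.-integrable setT (EFin \o X) ->
  mu.-integrable setT (EFin \o (fun w => a * X w)).
Proof. by move=> iX; apply: (integrableZl _ a iX). Qed.

Lemma integrable_EFin_cst (a : R) :
  mu.-integrable setT (EFin \o (fun=> a)).
Proof. exact: (finite_measure_integrable_cst mu). Qed.

Lemma integrable_EFin_sum n (X : 'I_n -> T -> R) :
  (forall i, mu.-integrable setT (EFin \o X i)) ->
  mu.-integrable setT (EFin \o (fun w => \sum_(i < n) X i w)).
Proof.
move=> iX; apply: (eq_integrable measurableT
    (fun w => (\sum_(i < n) (X i w)%:E)%E)).
  by move=> w _ /=; rewrite sumEFin.
by apply: (integrable_sum measurableT) => i _; exact: iX.
Qed.

Lemma Rintegral_sum n (X : 'I_n -> T -> R) :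
  (forall i, mu.-integrable setT (EFin \o X i)) ->
  \int[mu]_w (\sum_(i < n) X i w) = \sum_(i < n) \int[mu]_w X i w.
Proof.
elim: n X => [|n ih] X iX.
  under eq_Rintegral do rewrite big_ord0.
  by rewrite big_ord0 Rintegral_cst// mul0r.
under eq_Rintegral do rewrite big_ord_recr.
rewrite /= RintegralD//; last first.
  by apply: integrable_EFin_sum => i; exact: iX.
by rewrite big_ord_recr ih.
Qed.

Lemma Rintegral_cst1 (a : R) : \int[mu]_w a = a.
Proof.
rewrite Rintegral_cst// (_ : fine _ = 1) ?mulr1//.
exact: (congr1 fine (probability_setT mu)).
Qed.

Lemma integral_EFin_cst1 (a : R) : (\int[mu]_w a%:E = a%:E)%E.
Proof.
rewrite integral_cst//.
exact: (etrans (congr1 (mule a%:E) (probability_setT mu)) (mule1 _)).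
Qed.

Lemma EFin_Rintegral X : mu.-integrable setT (EFin \o X) ->
  (\int[mu]_w (X w)%:E = (\int[mu]_w X w)%:E)%E.
Proof. by move=> iX; rewrite fineK//; exact: integrable_fin_num. Qed.

Lemma integrable_ge0 X (c : R) : measurable_fun setT X ->
  (forall w, 0 <= X w) -> (\int[mu]_w (X w)%:E <= c%:E)%E ->
  mu.-integrable setT (EFin \o X) /\ \int[mu]_w X w <= c.
Proof.
move=> mX X0 Xc.
have iX : mu.-integrable setT (EFin \o X).
  apply/integrableP; split; first exact/measurable_EFinP.
  rewrite (le_lt_trans _ (ltry c))//; apply: le_trans Xc.
  rewrite le_eqVlt; apply/orP; left; apply/eqP.
  by apply: eq_integral => w _ /=; rewrite ger0_norm.
by split => //; rewrite -lee_fin -EFin_Rintegral.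
Qed.

End real_integrals.

Section directions.
Context (R : realType) (d : nat) (dO : measure_display)
  (Omega : measurableType dO) (Pr : probability Omega R).
Variables r m : \bar R.

(** Either form of the moment condition provides a finite bound on the fourth
    moments, common to all the directions. *)
Lemma fourth_moment_bound : exists2 m4 : R, 0 <= m4 &
  forall Z : Omega -> 'rV[R]_d, measurable_fun setT Z ->
    direction_assumption Pr r m Z ->
    forall i, (\int[Pr]_w ((Z w ord0 i ^+ 4)%:E) <= m4%:E)%E.
Proof.
have p0 (Z : Omega -> 'rV[R]_d) i : (0 <= \int[Pr]_w (Z w ord0 i ^+ 4)%:E)%E.
  by apply: integral_ge0 => w _; rewrite lee_fin exprn_even_ge0.
have [moo|moo] := ltP m +oo%E.
  exists (Num.max 0 (fine m)); first by rewrite le_max lexx.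
  move=> Z mZ [_ _ _ /(_ _) Zm _] i; move: (Zm i); rewrite unlock => {}Zm.
  have m0 := le_trans (p0 Z i) Zm.
  apply: (le_trans Zm); rewrite -[leLHS]fineK ?lee_fin ?le_max ?lexx ?orbT//.
  by rewrite ge0_fin_numE.
exists (fine r ^+ 4); first by rewrite exprn_even_ge0.
move=> Z mZ [_ _ Zr _ rm] i.
have roo : (r < +oo)%E by case: rm => //; rewrite ltNge moo.
have mZi : measurable_fun setT (fun w => (Z w ord0 i ^+ 4)%:E).
  apply/measurable_EFinP/measurable_funX.
  by have /measurable_rVP := mZ; exact.
apply: (@le_trans _ _ (\int[Pr]_w (fine r ^+ 4)%:E)%E).
  apply: ae_ge0_le_integral => //.
  - by move=> w _; rewrite lee_fin exprn_even_ge0.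
  - by move=> w _; rewrite lee_fin exprn_even_ge0.
  - apply: filterS (Zr i) => w /= Zw _; rewrite lee_fin.
    have {}Zw : `|Z w ord0 i| <= fine r.
      move: roo Zw; case: (r) => [r'|//|//] _ /=; first by rewrite lee_fin.
    rewrite -[leLHS](@ger0_norm _ (_ ^+ 4)) ?exprn_even_ge0// normrX.
    by rewrite lerXn2r// nnegrE// (le_trans _ Zw).
by rewrite integral_EFin_cst1.
Qed.

(** The unit second moments force both bounds to be at least 1. *)
Lemma D_zeta_ge1 (Z : Omega -> 'rV[R]_d) : (0 < d)%N ->
  measurable_fun setT Z -> direction_assumption Pr r m Z -> 1 <= D_zeta d r m.
Proof.
move=> d0 mZ [_ Z2 Zr Z4 rm]; pose i := Ordinal d0.
have mZi : measurable_fun setT (fun w => Z w ord0 i).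
  by have /measurable_rVP := mZ; exact.
have int1 : (\int[Pr]_w (Z w ord0 i ^+ 2)%:E = 1)%E.
  have := Z2 i i; rewrite eqxx unlock => <-.
  by apply: eq_integral => w _; rewrite expr2.
have r1 : (1 <= r)%E.
  rewrite leNgt; apply/negP => r1.
  have : (1 <= \int[Pr]_w (Num.max 0 (fine r) ^+ 2)%:E)%E.
    rewrite -int1; apply: ae_ge0_le_integral => //.
    - by move=> w _; rewrite lee_fin sqr_ge0.
    - exact/measurable_EFinP/measurable_funX.
    - by move=> w _; rewrite lee_fin sqr_ge0.
    - apply: filterS (Zr i) => w /= Zw _; rewrite lee_fin.
      have {}Zw : `|Z w ord0 i| <= fine r.
        move: r1 Zw; case: (r) => [r'|//|//] _ /=; first by rewrite lee_fin.
      rewrite -[leLHS]ger0_norm ?sqr_ge0// normrX.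
      by apply: lerXn2r; rewrite ?nnegrE ?le_max ?lexx ?Zw ?orbT.
  rewrite integral_EFin_cst1 lee_fin.
  rewrite leNgt => /negP; apply; rewrite expr_lt1// ?le_max ?lexx//.
  rewrite gt_max ltr01 /=; move: r1; case: (r) => [r'|//|_] /=.
    by rewrite lte_fin.
  exact: ltr01.
have m1 : (1 <= m)%E.
  rewrite leNgt; apply/negP => m1.
  have Zm : (\int[Pr]_w (Z w ord0 i ^+ 4)%:E <= m)%E.
    by have := Z4 i; rewrite unlock.
  have mE : m = (fine m)%:E.
    rewrite fineK// ge0_fin_numE ?(lt_trans m1) ?ltry//.
    apply: le_trans Zm; apply: integral_ge0 => w _.
    by rewrite lee_fin exprn_even_ge0.
  rewrite mE in m1 Zm.
  have [||iZ4 Zm'] := integrable_ge0 _ _ Zm.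
  - exact/measurable_funX.
  - by move=> w; rewrite exprn_even_ge0.
  have [|||iZ2 _] := @integrable_ge0 _ _ _ Pr (fun w => Z w ord0 i ^+ 2) 1 _ _ _.
  - exact/measurable_funX.
  - by move=> w; rewrite sqr_ge0.
  - by rewrite int1.
  have iY : Pr.-integrable setT (EFin \o (fun w => 2 * Z w ord0 i ^+ 2 + - 1)).
    apply: integrable_EFinD; last exact: integrable_EFin_cst.
    exact: integrable_EFinZ.
  have : \int[Pr]_w (2 * Z w ord0 i ^+ 2 + - 1) <= \int[Pr]_w (Z w ord0 i ^+ 4).
    apply: le_Rintegral => // w _; rewrite -subr_ge0.
    rewrite (_ : _ - _ = (Z w ord0 i ^+ 2 - 1) ^+ 2) ?sqr_ge0//.
    by ring.
  rewrite RintegralD//; last 2 first.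
    exact: integrable_EFinZ.
    exact: integrable_EFin_cst.
  rewrite RintegralZl// Rintegral_cst1.
  have -> : \int[Pr]_w (Z w ord0 i ^+ 2) = 1 by rewrite /Rintegral int1.
  by move: m1; rewrite lte_fin; lra.
have d1 : 0 < d%:R^-1 :> R by rewrite invr_gt0 ltr0n.
pose s := sqrte (1 + m * (d%:R^-1)%:E - (d%:R^-1)%:E)%E.
have s1 : (1 <= s)%E.
  rewrite /s; move: m1; case: (m) => [m'|_|//].
    rewrite lee_fin => m1; rewrite [sqrte _]/= lee_fin.
    rewrite -[leLHS]sqrtr1 ler_sqrt; last by nra.
    by nra.
  by rewrite gt0_mulye ?lte_fin// addey// addye//= leey.
rewrite -lee_fin /D_zeta fineK.
  by rewrite le_min r1 s1.
rewrite ge0_fin_numE; last by rewrite le_min !(le_trans _ r1) ?(le_trans _ s1).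
rewrite gt_min; case: rm => [->//|moo]; apply/orP; right.
move: m1 moo; case: (m) => [m'|//|//] _ _.
by rewrite [sqrte _]/= ltry.
Qed.

End directions.

(** * Mean of the step *)

Section direction_mean.
Context (R : realType) (d : nat) (dO : measure_display)
  (Omega : measurableType dO) (Pr : probability Omega R).
Variables (F : 'rV[R]_d -> R) (L l : R).
Hypotheses (L_gt0 : 0 < L) (l_gt0 : 0 < l).
Hypothesis F_diff : forall y, differentiable F y.
Hypothesis F_lip : lipschitz_gradient F L.
Hypothesis F_convex : strongly_convex F l.
Hypothesis F_meas : measurable_fun setT F.

(** The descent lemma bounds the error on one side, and convexity on the
    other. *)
Lemma first_order_error (x v : 'rV[R]_d) :
  `|F x - F (x + v) + dot (grad F x) v| <= L / 2 * dot v v.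
Proof.
have up := lipschitz_gradient_upper x v F_diff L_gt0 F_lip.
have := F_convex x (x + v); rewrite [_ + v - x]addrC addKr norm2_sqr => low.
have : 0 <= l / 2 * dot v v.
  by rewrite !mulr_ge0 ?dotvv_ge0// ltW.
by rewrite ler_norml; lra.
Qed.

Lemma cubic_le_quartic (s t : R) : `|t| * s ^+ 2 <= 1 + s ^+ 4 + t ^+ 4.
Proof.
have t0 := normr_ge0 t.
have -> : t ^+ 4 = `|t| ^+ 4 by rewrite -normrX ger0_norm// exprn_even_ge0.
set u := `|t| in t0 *.
(* |t| s^2 <= (t^2 + s^4) / 2 and t^2 <= 1 + t^4 *)
have h1 : 0 <= (u - s ^+ 2) ^+ 2 by exact: sqr_ge0.
have h2 : 0 <= (1 - u ^+ 2) ^+ 2 by exact: sqr_ge0.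
have h3 : 0 <= (s ^+ 2) ^+ 2 by exact: sqr_ge0.
have h4 : 0 <= (u ^+ 2) ^+ 2 by exact: sqr_ge0.
have -> : s ^+ 4 = (s ^+ 2) ^+ 2 by ring.
have -> : u ^+ 4 = (u ^+ 2) ^+ 2 by ring.
have e1 : (u - s ^+ 2) ^+ 2 = u ^+ 2 - 2 * (u * s ^+ 2) + (s ^+ 2) ^+ 2 by ring.
have e2 : (1 - u ^+ 2) ^+ 2 = 1 - 2 * u ^+ 2 + (u ^+ 2) ^+ 2 by ring.
lra.
Qed.

Variables (Z : Omega -> 'rV[R]_d) (r m : \bar R) (m4 : R).
Hypothesis Z_meas : measurable_fun setT Z.
Hypothesis Z_dir : direction_assumption Pr r m Z.
Hypothesis Z_m4 : forall i, (\int[Pr]_w ((Z w ord0 i ^+ 4)%:E) <= m4%:E)%E.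

Let Zc i : measurable_fun setT (fun w => Z w ord0 i).
Proof. by have /measurable_rVP := Z_meas; exact. Qed.

Let iZ4 i : Pr.-integrable setT (EFin \o (fun w => Z w ord0 i ^+ 4)) /\
  \int[Pr]_w (Z w ord0 i ^+ 4) <= m4.
Proof.
apply: integrable_ge0 => //; first exact: measurable_funX.
by move=> w; rewrite exprn_even_ge0.
Qed.

Let iW i j :
  let W := fun w => 1 + Z w ord0 i ^+ 4 + Z w ord0 j ^+ 4 in
  Pr.-integrable setT (EFin \o W) /\ \int[Pr]_w W w <= 1 + 2 * m4.
Proof.
move=> W; have [i4 Ei] := iZ4 i; have [j4 Ej] := iZ4 j.
have i1 := integrable_EFinD (integrable_EFin_cst Pr 1) i4.
split; first exact: integrable_EFinD.
rewrite RintegralD// RintegralD//; last exact: integrable_EFin_cst.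
by rewrite Rintegral_cst1; lra.
Qed.

Let iZZ i j : Pr.-integrable setT (EFin \o (fun w => Z w ord0 i * Z w ord0 j)).
Proof.
have [iWij _] := iW i j.
apply: (integrable_dominated _ iWij); first exact: measurable_funM.
move=> w; rewrite normrM.
set s := Z w ord0 i; set t := Z w ord0 j.
have -> : t ^+ 4 = `|t| ^+ 4 by rewrite -normrX ger0_norm// exprn_even_ge0.
have -> : s ^+ 4 = `|s| ^+ 4 by rewrite -normrX ger0_norm// exprn_even_ge0.
move: `|t| `|s| => u v.
have h1 : 0 <= (1 - u ^+ 2) ^+ 2 by exact: sqr_ge0.
have h2 : 0 <= (1 - v ^+ 2) ^+ 2 by exact: sqr_ge0.
have h3 : 0 <= (u - v) ^+ 2 by exact: sqr_ge0.
have h4 : 0 <= (u ^+ 2) ^+ 2 by exact: sqr_ge0.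
have h5 : 0 <= (v ^+ 2) ^+ 2 by exact: sqr_ge0.
have -> : v ^+ 4 = (v ^+ 2) ^+ 2 by ring.
have -> : u ^+ 4 = (u ^+ 2) ^+ 2 by ring.
have e1 : (u - v) ^+ 2 = u ^+ 2 - 2 * (v * u) + v ^+ 2 by ring.
have e2 : (1 - u ^+ 2) ^+ 2 = 1 - 2 * u ^+ 2 + (u ^+ 2) ^+ 2 by ring.
have e3 : (1 - v ^+ 2) ^+ 2 = 1 - 2 * v ^+ 2 + (v ^+ 2) ^+ 2 by ring.
lra.
Qed.

(** The mean of the exact step along one direction is - a grad F x, up to an
    error of order a^2. *)
Lemma direction_mean (x : 'rV[R]_d) (a : R) (j : 'I_d) :
  let Y := fun w => (F x - F (x + a *: Z w)) * Z w ord0 j in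
  Pr.-integrable setT (EFin \o Y) /\
  `|\int[Pr]_w Y w + a * grad F x ord0 j| <=
    L / 2 * (d%:R * (1 + 2 * m4)) * a ^+ 2.
Proof.
move=> Y; set g := grad F x.
(* a * B is the first-order part of - Y, and W dominates the remainder *)
pose B w := \sum_(i < d) g ord0 i * (Z w ord0 i * Z w ord0 j).
pose W w := \sum_(i < d) (1 + Z w ord0 i ^+ 4 + Z w ord0 j ^+ 4).
have iB : Pr.-integrable setT (EFin \o B).
  by apply: integrable_EFin_sum => i; exact/integrable_EFinZ/iZZ.
have EB : \int[Pr]_w B w = g ord0 j.
  rewrite Rintegral_sum; last by move=> i; exact/integrable_EFinZ/iZZ.
  under eq_bigr => i _ do rewrite RintegralZl//.
  rewrite (bigD1 j)//= big1 ?addr0 => [|i ij].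
    have [_ + _ _ _] := Z_dir; move=> /(_ j j).
    by rewrite unlock eqxx /Rintegral => ->; rewrite mulr1.
  have [_ + _ _ _] := Z_dir; move=> /(_ i j).
  by rewrite unlock (negbTE ij) /Rintegral => ->; rewrite mulr0.
have iWs : Pr.-integrable setT (EFin \o W).
  by apply: integrable_EFin_sum => i; exact: (iW i j).1.
have EW : \int[Pr]_w W w <= d%:R * (1 + 2 * m4).
  rewrite Rintegral_sum; last by move=> i; exact: (iW i j).1.
  rewrite -[d in d%:R]card_ord -sumr_const mulr_suml.
  by apply: ler_sum => i _; rewrite mul1r; exact: (iW i j).2.
have mY : measurable_fun setT Y.
  apply: measurable_funM => //; apply: measurable_funB => //.
  apply: measurableT_comp => //; apply: measurable_rVD => //.
  exact: measurable_rVZ.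
pose C := L / 2 * a ^+ 2.
have C0 : 0 <= C by rewrite mulr_ge0 ?sqr_ge0// divr_ge0// ltW.
have iCW := integrable_EFinZ C iWs.
have YB w : `|Y w + a * B w| <= C * W w.
  have -> : Y w + a * B w =
      (F x - F (x + a *: Z w) + dot g (a *: Z w)) * Z w ord0 j.
    rewrite mulrDl dotZr -mulrA; congr (_ + a * _).
    by rewrite /B /dot mulr_suml; apply: eq_bigr => i _; rewrite mulrA.
  rewrite normrM; apply: le_trans.
    by apply: ler_wpM2r (normr_ge0 _) _ _ _; exact: first_order_error.
  have -> : L / 2 * dot (a *: Z w) (a *: Z w) * `|Z w ord0 j| =
      C * (`|Z w ord0 j| * dot (Z w) (Z w)) by rewrite dotZl dotZr /C; ring.
  rewrite ler_wpM2l// mulr_sumr; apply: ler_sum => i _; rewrite -expr2.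
  exact: cubic_le_quartic.
have iYB : Pr.-integrable setT (EFin \o (fun w => Y w + a * B w)).
  apply: (integrable_dominated _ iCW YB); apply: measurable_funD => //.
  by apply/measurable_EFinP; apply: measurable_int (integrable_EFinZ a iB).
have iY : Pr.-integrable setT (EFin \o Y).
  have := integrable_EFinD iYB (integrable_EFinZ (- a) iB).
  by apply: eq_integrable => // w _ /=; congr EFin; ring.
split => //.
rewrite -EB -RintegralZl// -RintegralD//; last exact: integrable_EFinZ.
apply: le_trans; first exact: le_normr_Rintegral.
apply: (@le_trans _ _ (\int[Pr]_w (C * W w))).
  by apply: le_Rintegral => //; exact: (integrable_norm iYB).
rewrite RintegralZl// [leRHS]mulrAC ler_wpM2l//.
Qed.

End direction_mean.

Section mean_step.
Context (R : realType) (d : nat) (dX : measure_display)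
  (Xi : measurableType dX) (P : probability Xi R) (f : 'rV[R]_d -> Xi -> R).
Hypothesis f_measurable :
  measurable_fun setT (fun p : 'rV[R]_d * Xi => f p.1 p.2).
Hypothesis f_integrable : forall x, P.-integrable setT (fun u => (f x u)%:E).
Context (dO : measure_display) (Omega : measurableType dO)
  (Pr : probability Omega R).

Lemma Rintegral_same_law (X : Omega -> Xi) (g : Xi -> R) :
  measurable_fun setT X -> (forall A, measurable A -> Pr (X @^-1` A) = P A) ->
  measurable_fun setT g -> P.-integrable setT (EFin \o g) ->
  Pr.-integrable setT (EFin \o (fun w => g (X w))) /\
  \int[Pr]_w g (X w) = \int[P]_u g u.
Proof.
move=> mX lawX mg ig.
pose X' : {mfun Omega >-> Xi} := mfun_Sub (mem_set mX).
have law (A : set Xi) : measurable A -> A `<=` setT -> P A = distribution Pr X' A.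
  by move=> mA _; rewrite -lawX.
have mEg : measurable_fun setT (EFin \o g) by exact/measurable_EFinP.
have iX : Pr.-integrable setT (EFin \o (fun w => g (X w))).
  apply/integrableP; split; first exact: (measurableT_comp mEg mX).
  have := @ge0_integral_distribution _ _ _ _ _ Pr X' (abse \o (EFin \o g)).
  rewrite /= => <-//; last exact: measurableT_comp.
  rewrite -(eq_measure_integral _ law).
  by case/integrableP: ig.
split => //; congr fine.
rewrite -[LHS](@integral_distribution _ _ _ _ _ Pr X' (EFin \o g))//.
by rewrite -(eq_measure_integral _ law).
Qed.

Context (I : choiceType) (D : set I) (G : I -> set (set Omega)).
Hypothesis Gsigma : forall t, D t -> sigma_algebra setT (G t).
Hypothesis Gmeas : forall t, D t -> G t `<=` measurable.
Hypothesis indepG : mutual_independence Pr D G.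
Variables A B : set I.
Hypotheses (AD : A `<=` D) (BD : B `<=` D) (AB0 : A `&` B = set0).
Variables (c : sgfd_choice) (n q : nat).
Hypotheses (n_gt0 : (0 < n)%N) (q_gt0 : (0 < q)%N).
Variables (xi : nat -> nat -> Omega -> Xi) (zeta : nat -> Omega -> 'rV[R]_d).
Hypothesis zeta_meas : forall i, uses_zeta c n i ->
  measurable_fun setT (zeta i : join_space G A -> 'rV[R]_d).
Hypothesis xi_meas : forall i j, uses_xi c n q i j ->
  measurable_fun setT (xi i j : join_space G B -> Xi).
Hypothesis xi_law : forall i j, uses_xi c n q i j ->
  forall U, measurable U -> Pr (xi i j @^-1` U) = P U.

Let S (h : 'rV[R]_d -> Xi -> R) x a w w' : 'rV[R]_d :=
  sgfd_step c h n q x a (fun i j => xi i j w') (fun i => zeta i w).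

(* Averaging over the samples xi, with the directions held fixed. *)
Let inner x a w j :
  Pr.-integrable setT (EFin \o (fun w' => S f x a w w' ord0 j)) /\
  forall w1, \int[Pr]_w' S f x a w w' ord0 j =
    S (fun y _ => objective P f y) x a w w1 ord0 j.
Proof.
have [N [Q [tau [NQ0 NQ Ntau stepE]]]] :=
  sgfd_stepE R d Xi c n_gt0 q_gt0.
have fE y i k : (i < N)%N -> (k < Q)%N ->
    Pr.-integrable setT (EFin \o (fun w' => f y (xi i k w'))) /\
    \int[Pr]_w' f y (xi i k w') = objective P f y.
  move=> iN kQ; have ik := NQ i k iN kQ.
  apply: Rintegral_same_law; [|exact: xi_law| |exact: f_integrable].
    by have := measurableT_comp (xi_meas ik) (measurable_id_join Gmeas BD).
  exact: measurable_section.
pose t y (i : 'I_N) (k : 'I_Q) w' :=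
  zeta (tau i) w ord0 j * (f x (xi i k w') + - 1 * f y (xi i k w')).
have tE y i k : Pr.-integrable setT (EFin \o t y i k) /\
    \int[Pr]_w' t y i k w' =
    zeta (tau i) w ord0 j * (objective P f x + - 1 * objective P f y).
  have [ix Ex] := fE x i k (ltn_ord i) (ltn_ord k).
  have [iy Ey] := fE y i k (ltn_ord i) (ltn_ord k).
  have ixy := integrable_EFinD ix (integrable_EFinZ (- 1) iy).
  split; first exact: integrable_EFinZ.
  rewrite RintegralZl// RintegralD//; last exact: integrable_EFinZ.
  by rewrite RintegralZl// Ex Ey.
have SE w' : S f x a w w' ord0 j = (N * Q)%:R^-1 *
    \sum_(i < N) \sum_(k < Q) t (x + a *: zeta (tau i) w) i k w'.
  rewrite /S stepE mxE summxE; congr (_ * _); apply: eq_bigr => i _.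
  rewrite summxE; apply: eq_bigr => k _; rewrite mxE mulrC /t; congr (_ * _).
  by rewrite mulN1r.
have iS : Pr.-integrable setT (EFin \o (fun w' =>
    \sum_(i < N) \sum_(k < Q) t (x + a *: zeta (tau i) w) i k w')).
  apply: integrable_EFin_sum => i; apply: integrable_EFin_sum => k.
  exact: (tE _ _ _).1.
split.
  have := integrable_EFinZ (N * Q)%:R^-1 iS.
  by apply: eq_integrable => // w' _ /=; rewrite SE.
move=> w1; under eq_Rintegral do rewrite SE.
rewrite RintegralZl// Rintegral_sum; last first.
  by move=> i; apply: integrable_EFin_sum => k; exact: (tE _ _ _).1.
rewrite /S stepE mxE summxE; congr (_ * _); apply: eq_bigr => i _.
rewrite Rintegral_sum; last by move=> k; exact: (tE _ _ _).1.
rewrite summxE; apply: eq_bigr => k _; rewrite (tE _ _ _).2 mxE mulrC.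
by rewrite mulN1r.
Qed.

(** The conditional expectation of the step given the directions replaces the
    samples of f by the objective. *)
Lemma mean_step_objective x a j :
  Pr.-integrable setT (EFin \o (fun w => S f x a w w ord0 j)) ->
  \int[Pr]_w S f x a w w ord0 j =
  \int[Pr]_w S (fun y _ => objective P f y) x a w w ord0 j.
Proof.
move=> iS; congr fine.
pose h (z : join_space G A * join_space G B) := (S f x a z.1 z.2 ord0 j)%:E.
have mh : measurable_fun setT h.
  apply/measurable_EFinP.
  have : measurable_fun setT
      (fun z : join_space G A * join_space G B => S f x a z.1 z.2).
    apply: measurable_sgfd_step => //.
    - move=> i k /xi_meas mx.
      exact: (measurableT_comp mx (@measurable_snd _ _ _ _)).
    - move=> i /zeta_meas mz.
      exact: (measurableT_comp mz (@measurable_fst _ _ _ _)).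
  by move=> /measurable_rVP; exact.
have := integral_freeze Gsigma Gmeas indepG AD BD AB0 mh iS.
move=> -> => [|w]; last exact: (inner x a w j).1.
apply: eq_integral => w _.
have [iw Ew] := inner x a w j.
by rewrite -(Ew w); exact: (EFin_Rintegral iw).
Qed.

End mean_step.

Section mean_step_error.
Context (R : realType) (d : nat) (dX : measure_display)
  (Xi : measurableType dX) (P : probability Xi R) (f : 'rV[R]_d -> Xi -> R).
Hypothesis f_measurable :
  measurable_fun setT (fun p : 'rV[R]_d * Xi => f p.1 p.2).
Hypothesis f_integrable : forall x, P.-integrable setT (fun u => (f x u)%:E).
Variables (L l : R).
Local Notation F := (objective P f).
Hypotheses (L_gt0 : 0 < L) (l_gt0 : 0 < l).
Hypothesis F_diff : forall y, differentiable F y.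
Hypothesis F_lip : lipschitz_gradient F L.
Hypothesis F_convex : strongly_convex F l.
Context (dO : measure_display) (Omega : measurableType dO)
  (Pr : probability Omega R).
Context (I : choiceType) (D : set I) (G : I -> set (set Omega)).
Hypothesis Gsigma : forall t, D t -> sigma_algebra setT (G t).
Hypothesis Gmeas : forall t, D t -> G t `<=` measurable.
Hypothesis indepG : mutual_independence Pr D G.
Variables A B : set I.
Hypotheses (AD : A `<=` D) (BD : B `<=` D) (AB0 : A `&` B = set0).
Variables (c : sgfd_choice) (n q : nat).
Hypotheses (n_gt0 : (0 < n)%N) (q_gt0 : (0 < q)%N).
Variables (xi : nat -> nat -> Omega -> Xi) (zeta : nat -> Omega -> 'rV[R]_d).
Hypothesis zeta_meas : forall i, uses_zeta c n i ->
  measurable_fun setT (zeta i : join_space G A -> 'rV[R]_d).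
Hypothesis xi_meas : forall i j, uses_xi c n q i j ->
  measurable_fun setT (xi i j : join_space G B -> Xi).
Hypothesis xi_law : forall i j, uses_xi c n q i j ->
  forall U, measurable U -> Pr (xi i j @^-1` U) = P U.
Variables (r m : \bar R) (m4 : R).
Hypothesis zeta_dir : forall i, uses_zeta c n i ->
  direction_assumption Pr r m (zeta i).
Hypothesis zeta_m4 : forall i, uses_zeta c n i ->
  forall j, (\int[Pr]_w ((zeta i w ord0 j ^+ 4)%:E) <= m4%:E)%E.

(** [direction_mean] averaged over the pairs of [sgfd_stepE]. *)
Lemma mean_step_error x a j :
  let S := fun w =>
    sgfd_step c f n q x a (fun i k => xi i k w) (fun i => zeta i w) in
  Pr.-integrable setT (EFin \o (fun w => S w ord0 j)) ->
  `|\int[Pr]_w S w ord0 j + a * grad F x ord0 j| <=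
    L / 2 * (d%:R * (1 + 2 * m4)) * a ^+ 2.
Proof.
move=> S iS.
rewrite (mean_step_objective f_measurable f_integrable Gsigma Gmeas indepG
  AD BD AB0 n_gt0 q_gt0 zeta_meas xi_meas xi_law iS).
have [N [Q [tau [NQ0 NQ Ntau stepE]]]] := sgfd_stepE R d Xi c n_gt0 q_gt0.
set K := L / 2 * _.
pose Y (i : nat) w := (F x - F (x + a *: zeta (tau i) w)) * zeta (tau i) w ord0 j.
have YP (i : 'I_N) : Pr.-integrable setT (EFin \o Y i) /\
    `|\int[Pr]_w Y i w + a * grad F x ord0 j| <= K * a ^+ 2.
  have ui := Ntau i (ltn_ord i).
  apply: (direction_mean L_gt0 l_gt0 F_diff F_lip F_convex _ _ (zeta_dir ui)).
  - exact: measurable_objective.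
  - by have := measurableT_comp (zeta_meas ui) (measurable_id_join Gmeas AD).
  - exact: zeta_m4.
have iYs (i : 'I_N) : Pr.-integrable setT (EFin \o (fun w => \sum_(k < Q) Y i w)).
  by apply: integrable_EFin_sum => k; exact: (YP i).1.
under eq_Rintegral => w _.
  rewrite stepE mxE summxE.
  under eq_bigr => i _.
    rewrite summxE; under eq_bigr => k _ do rewrite mxE -/(Y i w).
    over.
  over.
rewrite RintegralZl//; last exact: integrable_EFin_sum.
rewrite Rintegral_sum//.
have NQ1 : 0 < (N * Q)%:R :> R by rewrite ltr0n.
set g := grad F x ord0 j in YP *.
have sumNQ (v : R) : \sum_(i < N) \sum_(k < Q) v = (N * Q)%:R * v.
  by rewrite !sumr_const !card_ord -mulrnA mulr_natl mulnC.
rewrite -[a * g](mulKf (lt0r_neq0 NQ1)) -sumNQ -mulrDr -big_split/=.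
rewrite normrM ger0_norm ?invr_ge0 ?ler0n// mulrC ler_pdivrMr//.
rewrite [leRHS]mulrC -sumNQ.
apply: le_trans; first exact: ler_norm_sum.
apply: ler_sum => i _.
rewrite Rintegral_sum => [|k]; last exact: (YP i).1.
rewrite -big_split; apply: le_trans; first exact: ler_norm_sum.
by apply: ler_sum => k _; exact: (YP i).2.
Qed.

End mean_step_error.

(** * Decrease of the objective in one step *)

Section one_step.
Context (R : realType) (d : nat) (dO : measure_display)
  (Omega : measurableType dO) (Pr : probability Omega R).
Variables (F : 'rV[R]_d -> R) (L l : R) (xstar : 'rV[R]_d).
Hypotheses (L_gt0 : 0 < L) (l_gt0 : 0 < l).
Hypothesis F_diff : forall y, differentiable F y.
Hypothesis F_lip : lipschitz_gradient F L.
Hypothesis F_convex : strongly_convex F l.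
Hypothesis F_meas : measurable_fun setT F.
Hypothesis F_min : forall y, F xstar <= F y.

Lemma mean_coord (S : Omega -> 'rV[R]_d) j :
  mean Pr S ord0 j = \int[Pr]_w S w ord0 j.
Proof. by rewrite mxE unlock. Qed.

(** A bound on the variance is a bound on the second moment; in particular
    every coordinate is then integrable. *)
Lemma variance_second_moment (S : Omega -> 'rV[R]_d) (V : R) :
  measurable_fun setT S -> (vec_variance Pr S <= V%:E)%E ->
  [/\ Pr.-integrable setT (EFin \o (fun w => dot (S w) (S w))),
      \int[Pr]_w dot (S w) (S w) <= V + dot (mean Pr S) (mean Pr S) &
      forall j, Pr.-integrable setT (EFin \o (fun w => S w ord0 j))].
Proof.
move=> mS; rewrite /vec_variance unlock norm2_sqr.
rewrite leeBlDr// -EFinD => SV.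
have [|||iS ES] := @integrable_ge0 _ _ _ Pr (fun w => dot (S w) (S w))
  (V + dot (mean Pr S) (mean Pr S)).
- exact: measurable_dot.
- by move=> w; exact: dotvv_ge0.
- apply: le_trans SV; rewrite le_eqVlt; apply/orP; left; apply/eqP.
  by apply: eq_integral => w _; rewrite norm2_sqr.
split => // j.
have i1 := integrable_EFinD (integrable_EFin_cst Pr 1) iS.
apply: (integrable_dominated _ i1).
  by have /measurable_rVP := mS; exact.
move=> w; rewrite /dot (bigD1 j)//=.
have : 0 <= \sum_(i < d | i != j) S w ord0 i * S w ord0 i.
  by apply: sumr_ge0 => i _; rewrite -expr2 sqr_ge0.
have -> : S w ord0 j * S w ord0 j = `|S w ord0 j| ^+ 2.
  by rewrite -normrX ger0_norm ?sqr_ge0// expr2.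
move: `|S w ord0 j| (\sum_(i < d | _) _) => s t t0.
have : 0 <= (1 - s) ^+ 2 by exact: sqr_ge0.
have -> : (1 - s) ^+ 2 = 1 - 2 * s + s ^+ 2 by ring.
have : 0 <= s ^+ 2 by exact: sqr_ge0.
by lra.
Qed.

(** The bound for a step S whose mean is - a g up to an error K a^2 in each
    coordinate, g being the gradient at x. *)
Lemma one_step (S : Omega -> 'rV[R]_d) (x : 'rV[R]_d) (a M MV K eps : R) :
  0 < a -> 0 < eps -> 0 <= M -> 0 <= MV -> L * (MV + 2) * a <= 1 ->
  measurable_fun setT S ->
  (vec_variance Pr S <=
    (a ^+ 2 * M + a ^+ 2 * MV * norm2 (grad F x) ^+ 2)%:E)%E ->
  (forall j, Pr.-integrable setT (EFin \o (fun w => S w ord0 j)) ->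
    `|\int[Pr]_w S w ord0 j + a * grad F x ord0 j| <= K * a ^+ 2) ->
  (\int[Pr]_w (F (x + S w) - F xstar)%:E <=
   (F x - F xstar - a * (1 / 2 - eps) * dot (grad F x) (grad F x) +
    a ^+ 2 * (d%:R * K ^+ 2 * a / (4 * eps) + L * M / 2 +
              L * (d%:R * K ^+ 2) * a ^+ 2))%:E)%E.
Proof.
move=> a0 eps0 M0 MV0 aL mS; rewrite norm2_sqr => varS meanS.
set g := grad F x in varS meanS *.
have [iSS ESS iS] := variance_second_moment mS varS.
pose s := mean Pr S; pose e := s + a *: g.
have ee : dot e e <= d%:R * K ^+ 2 * a ^+ 4.
  rewrite -mulrA -[d in d%:R]card_ord -sumr_const mulr_suml.
  apply: ler_sum => j _; rewrite mul1r -expr2.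
  rewrite !mxE -/(mean Pr S) unlock.
  have := meanS j (iS j); set E := \int[Pr]_w _.
  rewrite -[fine _]/E => Ej.
  rewrite -[leLHS]ger0_norm ?sqr_ge0// normrX.
  rewrite (_ : K ^+ 2 * a ^+ 4 = (K * a ^+ 2) ^+ 2); last by ring.
  rewrite !mxE in Ej; rewrite lerXn2r ?nnegrE//; exact: le_trans Ej.
have sE : s = (- a) *: g + e by rewrite /e addrC scaleNr addrK.
have gs : dot g s = - a * dot g g + dot g e by rewrite sE dotDr dotZr.
have ge : dot g e <= eps * a * dot g g + (4 * (eps * a))^-1 * dot e e.
  by apply: dot_young; rewrite mulr_gt0.
have ss : dot s s <= 2 * (a ^+ 2 * dot g g) + 2 * dot e e.
  have := dot_add_sqr_le ((- a) *: g) e.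
  by rewrite -sE dotZl dotZr (_ : - a * (- a * dot g g) = a ^+ 2 * dot g g)//; ring.
pose U w := F x - F xstar + \sum_(j < d) g ord0 j * S w ord0 j +
            L / 2 * dot (S w) (S w).
have iGS : Pr.-integrable setT (EFin \o
    (fun w => \sum_(j < d) g ord0 j * S w ord0 j)).
  by apply: integrable_EFin_sum => j; exact: integrable_EFinZ.
have iGS1 := integrable_EFinD (integrable_EFin_cst Pr (F x - F xstar)) iGS.
have iU : Pr.-integrable setT (EFin \o U).
  by apply: integrable_EFinD => //; exact: integrable_EFinZ.
have FU w : F (x + S w) - F xstar <= U w.
  have := lipschitz_gradient_upper x (S w) F_diff L_gt0 F_lip.
  by rewrite /U -/(dot g (S w)) -/g; lra.
have mFS : measurable_fun setT (fun w => F (x + S w) - F xstar).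
  apply: measurable_funB => //; apply: measurableT_comp => //.
  exact: measurable_rVD.
apply: (@le_trans _ _ (\int[Pr]_w (U w)%:E)%E).
  apply: ge0_le_integral => //.
  - by move=> w _; rewrite lee_fin subr_ge0.
  - exact/measurable_EFinP.
  - exact: measurable_int iU.
  - by move=> w _; rewrite lee_fin.
rewrite EFin_Rintegral// lee_fin RintegralD//; last exact: integrable_EFinZ.
rewrite RintegralD//; last exact: integrable_EFin_cst.
rewrite Rintegral_cst1 RintegralZl// Rintegral_sum; last first.
  by move=> j; exact: integrable_EFinZ.
have -> : \sum_(j < d) \int[Pr]_w (g ord0 j * S w ord0 j) = dot g s.
  by apply: eq_bigr => j _; rewrite RintegralZl// mean_coord.
have gg0 := dotvv_ge0 g.
have ee0 := dotvv_ge0 e.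
(* the quadratic terms in g are absorbed by the stepsize restriction *)
have absorb : L / 2 * (a ^+ 2 * MV * dot g g + 2 * (a ^+ 2 * dot g g)) <=
    a / 2 * dot g g.
  have -> : L / 2 * (a ^+ 2 * MV * dot g g + 2 * (a ^+ 2 * dot g g)) =
    (L * (MV + 2) * a) * (a / 2 * dot g g) by ring.
  by rewrite ler_piMl// mulr_ge0// divr_ge0// ltW.
have second : L / 2 * \int[Pr]_w dot (S w) (S w) <=
    L / 2 * (a ^+ 2 * M + a ^+ 2 * MV * dot g g +
      (2 * (a ^+ 2 * dot g g) + 2 * dot e e)).
  apply: ler_wpM2l; first by rewrite divr_ge0// ltW.
  apply: (le_trans ESS).
  by rewrite lerD2l.
have Le : L * dot e e <= L * (d%:R * K ^+ 2 * a ^+ 4) by rewrite ler_wpM2l// ltW.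
have ge' : (4 * (eps * a))^-1 * dot e e <=
    (4 * (eps * a))^-1 * (d%:R * K ^+ 2 * a ^+ 4).
  by rewrite ler_wpM2l// invr_ge0 ltW// !mulr_gt0.
have ea : (4 * (eps * a))^-1 * (d%:R * K ^+ 2 * a ^+ 4) =
    a ^+ 2 * (d%:R * K ^+ 2 * a / (4 * eps)).
  by field; rewrite !gt_eqF.
have La : L * (d%:R * K ^+ 2 * a ^+ 4) = a ^+ 2 * (L * (d%:R * K ^+ 2) * a ^+ 2).
  by ring.
rewrite ea in ge'; rewrite La in Le.
rewrite gs.
move: second absorb ge ge' Le.
move: (dot g g) (dot e e) (dot g e) (\int[Pr]_w dot (S w) (S w)) => G EE GE SS.
set X1 := a ^+ 2 * (d%:R * K ^+ 2 * a / (4 * eps)).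
set X2 := a ^+ 2 * (L * (d%:R * K ^+ 2) * a ^+ 2).
have -> : a ^+ 2 * (d%:R * K ^+ 2 * a / (4 * eps) + L * M / 2 +
   L * (d%:R * K ^+ 2) * a ^+ 2) = X1 + L / 2 * (a ^+ 2 * M) + X2.
  by rewrite /X1 /X2; ring.
lra.
Qed.

Lemma strong_convexity_le_lipschitz : (0 < d)%N -> l <= L.
Proof.
move=> d0; pose v : 'rV[R]_d := delta_mx ord0 (Ordinal d0).
have vv : 0 < dot v v.
  rewrite /dot (bigD1 (Ordinal d0))//= /v !mxE !eqxx mulr1.
  by rewrite ltr_pwDl// sumr_ge0// => i _; rewrite -expr2 sqr_ge0.
have := lipschitz_gradient_upper 0 v F_diff L_gt0 F_lip.
have := F_convex 0 (0 + v); rewrite [_ + v - _]addrC addKr norm2_sqr => h1 h2.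
have : l / 2 * dot v v <= L / 2 * dot v v by lra.
by rewrite ler_pM2r//; lra.
Qed.

End one_step.

(** * The expected optimality gap along the iterates *)

(** The step at which a seed is drawn. *)
Definition seed_step (t : seed_index) : nat :=
  match t with inl (k, _, _) => k | inr (k, _) => k end.

Section iterates.
Context (R : realType) (d : nat) (dX : measure_display)
  (Xi : measurableType dX) (P : probability Xi R) (f : 'rV[R]_d -> Xi -> R).
Hypothesis f_measurable :
  measurable_fun setT (fun p : 'rV[R]_d * Xi => f p.1 p.2).
Hypothesis f_integrable : forall x, P.-integrable setT (fun u => (f x u)%:E).
Local Notation F := (objective P f).
Variables (L l : R) (xstar : 'rV[R]_d).
Hypotheses (L_gt0 : 0 < L) (l_gt0 : 0 < l).
Hypothesis F_diff : forall y, differentiable F y.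
Hypothesis F_lip : lipschitz_gradient F L.
Hypothesis F_convex : strongly_convex F l.
Hypothesis F_min : forall y, F xstar <= F y.
Context (dO : measure_display) (Omega : measurableType dO)
  (Pr : probability Omega R).
Variables (c : sgfd_choice) (n q : nat -> nat).
Hypothesis n_gt0 : forall k, (0 < k)%N -> (0 < n k)%N.
Hypothesis q_gt0 : forall k, (0 < k)%N -> (0 < q k)%N.
Variables (xi : nat -> nat -> nat -> Omega -> Xi)
  (zeta : nat -> nat -> Omega -> 'rV[R]_d).
Hypothesis sampling : sgfd_sampling Pr c n q P xi zeta.
Variables (alpha : nat -> R) (x1 : 'rV[R]_d) (x : nat -> Omega -> 'rV[R]_d).
Hypothesis run : sgfd_run c f n q alpha xi zeta x1 x.
Variables r m : \bar R.
Hypothesis directions : forall k i, seeds c n q (inr (k, i)) ->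
  direction_assumption Pr r m (zeta k i).
Variables M MV : R.
Hypotheses (M_ge0 : 0 <= M) (MV_ge0 : 0 <= MV).
Hypothesis variance_bound :
  variance_assumption Pr c f n q alpha xi zeta x F M MV.

Let D := seeds c n q.
Let G := seed_sigma xi zeta.

Lemma seed_sigma_algebra t : D t -> sigma_algebra setT (G t).
Proof.
by case: t => [[[k i] j]|[k i]] _ /=;
  exact/sigma_algebra_preimage/sigma_algebra_measurable.
Qed.

Lemma seed_sigma_measurable t : D t -> G t `<=` measurable.
Proof.
have [mxi mzeta _ _] := sampling.
by case: t => [[[k i] j]|[k i]] Dt _ [U mU <-] /=;
  [apply: (mxi _ _ _ Dt).1|apply: (mzeta _ _ Dt)].
Qed.

(** The seeds drawn before step k, those drawn at step k, and among the latter
    the directions and the samples. *)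
Definition past (k : nat) : set seed_index :=
  [set t | seeds c n q t /\ (seed_step t < k)%N].
Definition current (k : nat) : set seed_index :=
  [set t | seeds c n q t /\ seed_step t = k].
Definition current_directions (k : nat) : set seed_index :=
  [set t | seeds c n q t /\ exists i, t = inr (k, i)].
Definition current_samples (k : nat) : set seed_index :=
  [set t | seeds c n q t /\ exists i j, t = inl (k, i, j)].

Let join_xi (A : set seed_index) k i j : A (inl (k, i, j)) ->
  measurable_fun setT (xi k i j : join_space G A -> Xi).
Proof. by move=> At; exact: (measurable_join_in At). Qed.

Let join_zeta (A : set seed_index) k i : A (inr (k, i)) ->
  measurable_fun setT (zeta k i : join_space G A -> 'rV[R]_d).
Proof. by move=> At; exact: (measurable_join_in At). Qed.

Lemma iterate_measurable k : (0 < k)%N ->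
  measurable_fun setT (x k : join_space G (past k) -> 'rV[R]_d).
Proof.
case: run => x1E xS; elim: k => // -[_ _|k ih _].
  have -> : x 1%N = cst x1 by apply/funext => w; rewrite x1E.
  exact: measurable_cst.
have -> : x k.+2 = fun w => x k.+1 w +
    sgfd_random_step c f n q alpha xi zeta k.+1 (x k.+1 w) w.
  by apply/funext => w; rewrite xS.
have mx : measurable_fun setT (x k.+1 : join_space G (past k.+2) -> 'rV[R]_d).
  apply: (measurable_join_sub (A := past k.+1)); last exact: ih.
  by move=> t [Dt tk]; split => //; rewrite (ltn_trans tk).
apply: measurable_rVD => //.
apply: measurable_sgfd_step => //; [exact: n_gt0|exact: q_gt0|..].
- by move=> i j u; apply: join_xi.
- by move=> i u; apply: join_zeta.
Qed.

Let pastD k : past k `<=` D. Proof. by move=> t []. Qed.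
Let currentD k : current k `<=` D. Proof. by move=> t []. Qed.
Let past_current k : past k `&` current k = set0.
Proof. by rewrite -subset0 => t [[_ tk] [_ tE]]; rewrite tE ltnn in tk. Qed.

Let F_meas : measurable_fun setT F.
Proof. exact: measurable_objective. Qed.

(** The optimality gap of the k-th iterate. *)
Let gap k w := F (x k w) - F xstar.

Let x_meas k : (0 < k)%N -> measurable_fun setT (x k).
Proof.
move=> /iterate_measurable mk.
by have := measurableT_comp mk (measurable_id_join seed_sigma_measurable (@pastD k)).
Qed.

Let gap_meas k : (0 < k)%N -> measurable_fun setT (gap k).
Proof.
move=> k0; apply: measurable_funB => //; apply: measurableT_comp => //.
exact: x_meas.
Qed.

Let next_gap_meas k (d1 d2 : measure_display) (T1 : measurableType d1)
    (T2 : measurableType d2) (y : T1 -> 'rV[R]_d) (xi' : nat -> nat -> T2 -> Xi)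
    (zeta' : nat -> T2 -> 'rV[R]_d) : (0 < k)%N ->
  measurable_fun setT y ->
  (forall i j, uses_xi c (n k) (q k) i j -> measurable_fun setT (xi' i j)) ->
  (forall i, uses_zeta c (n k) i -> measurable_fun setT (zeta' i)) ->
  measurable_fun setT (fun z : T1 * T2 =>
    (F (y z.1 + sgfd_step c f (n k) (q k) (y z.1) (alpha k)
       (fun i j => xi' i j z.2) (fun i => zeta' i z.2)) - F xstar)%:E).
Proof.
move=> k0 my mxi mzeta.
apply/measurable_EFinP; apply: measurable_funB => //.
apply: measurableT_comp => //.
have my1 := measurableT_comp my (@measurable_fst _ _ T1 T2).
apply: measurable_rVD; first exact: my1.
apply: measurable_sgfd_step => //; [exact: n_gt0|exact: q_gt0|..].
- by move=> i j /mxi mx; exact: (measurableT_comp mx (@measurable_snd _ _ _ _)).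
- by move=> i /mzeta mz; exact: (measurableT_comp mz (@measurable_snd _ _ _ _)).
Qed.

(** The seeds of step k are independent of the iterate x k, so that the latter
    can be held fixed while averaging over the former. *)
Lemma gap_freeze k : (0 < k)%N ->
  (\int[Pr]_w (gap k.+1 w)%:E = \int[Pr]_w \int[Pr]_w'
    (F (x k w + sgfd_random_step c f n q alpha xi zeta k (x k w) w') -
     F xstar)%:E)%E.
Proof.
move=> k0; case: run => x1E xS.
pose h (z : join_space G (past k) * join_space G (current k)) :=
  (F (x k z.1 + sgfd_random_step c f n q alpha xi zeta k (x k z.1) z.2) -
     F xstar)%:E.
have mh : measurable_fun setT h.
  apply: (@next_gap_meas k _ _ (join_space G (past k))
    (join_space G (current k)) (x k) (xi k) (zeta k) k0).
  - exact: (iterate_measurable k0).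
  - by move=> i j u; apply: join_xi; split => //=; rewrite k0.
  - by move=> i u; apply: join_zeta; split => //=; rewrite k0.
have [_ _ _ indep] := sampling.
have := ge0_integral_freeze seed_sigma_algebra seed_sigma_measurable indep
  (@pastD k) (@currentD k) (past_current k) mh.
move=> <-; first by apply: eq_integral => w _; rewrite /gap /h xS.
by move=> z; rewrite lee_fin subr_ge0.
Qed.

Variable m4 : R.
Hypothesis m4_bound : forall k i, seeds c n q (inr (k, i)) ->
  forall j, (\int[Pr]_w ((zeta k i w ord0 j ^+ 4)%:E) <= m4%:E)%E.

(* the constant of mean_step_error *)
Let K := L / 2 * (d%:R * (1 + 2 * m4)).

(** The contraction for step k started from a fixed point y at which the
    variance bound holds. *)
Lemma sgfd_one_step k y eps : (0 < k)%N -> 0 < alpha k -> 0 < eps ->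
  eps < 2^-1 -> L * (MV + 2) * alpha k <= 1 ->
  let S := sgfd_random_step c f n q alpha xi zeta k y in
  (vec_variance Pr S <=
     (alpha k ^+ 2 * M + alpha k ^+ 2 * MV * norm2 (grad F y) ^+ 2)%:E)%E ->
  (\int[Pr]_w (F (y + S w) - F xstar)%:E <=
   ((1 - alpha k * (l * (1 - 2 * eps))) * (F y - F xstar) +
    alpha k ^+ 2 * (d%:R * K ^+ 2 * alpha k / (4 * eps) + L * M / 2 +
              L * (d%:R * K ^+ 2) * alpha k ^+ 2))%:E)%E.
Proof.
move=> k0 a0 eps0 eps2 aL S varS.
have [mxi mzeta _ indep] := sampling.
have [xi_law zeta_k] : (forall i j, uses_xi c (n k) (q k) i j ->
    seeds c n q (inl (k, i, j))) /\
   (forall i, uses_zeta c (n k) i -> seeds c n q (inr (k, i))).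
  by split => [i j u|i u]; rewrite /= k0.
have dirD : current_directions k `<=` D by move=> t [].
have samD : current_samples k `<=` D by move=> t [].
have dis : current_directions k `&` current_samples k = set0.
  by rewrite -subset0 => t [[_ [i ->]] [_ [i' [j]]]].
have mS : measurable_fun setT S.
  apply: measurable_sgfd_step => //; [exact: n_gt0|exact: q_gt0|..].
  - by move=> i j /xi_law u; exact: (mxi _ _ _ u).1.
  - by move=> i /zeta_k u; exact: mzeta.
have err j : Pr.-integrable setT (EFin \o (fun w => S w ord0 j)) ->
    `|\int[Pr]_w S w ord0 j + alpha k * grad F y ord0 j| <= K * alpha k ^+ 2.
  apply: (mean_step_error f_measurable f_integrable L_gt0 l_gt0 F_diff F_lip
    F_convex seed_sigma_algebra seed_sigma_measurable indep dirD samD dis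
    (n_gt0 k0) (q_gt0 k0) _ _ _ _ _ (xi := xi k) (zeta := zeta k)).
  - by move=> i /zeta_k u; apply: join_zeta; split => //; exists i.
  - by move=> i i' /xi_law u; apply: join_xi; split => //; exists i, i'.
  - by move=> i i' /xi_law u; exact: (mxi _ _ _ u).2.
  - by move=> i /zeta_k; exact: directions.
  - by move=> i /zeta_k; exact: m4_bound.
have := one_step L_gt0 F_diff F_lip F_meas F_min a0 eps0 M_ge0 MV_ge0 aL mS varS err.
move=> /le_trans; apply; rewrite lee_fin lerD2r.
have := strongly_convex_gradient_lower y xstar l_gt0 F_convex.
move: (dot _ _) (F y - F xstar) => g b bg.
have ae : 0 <= alpha k * (1 / 2 - eps) by rewrite mulr_ge0 ?ltW//; lra.
have := ler_wpM2l ae bg.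
rewrite (_ : alpha k * (1 / 2 - eps) * (2 * l * b) =
  alpha k * (l * (1 - 2 * eps)) * b); last by field.
by lra.
Qed.

(** [sgfd_one_step] averaged over the iterate x k. *)
Lemma gap_recursion k eps C : (0 < k)%N -> 0 < alpha k -> 0 < eps ->
  eps < 2^-1 -> L * (MV + 2) * alpha k <= 1 ->
  alpha k * (l * (1 - 2 * eps)) <= 1 ->
  d%:R * K ^+ 2 * alpha k / (4 * eps) + L * M / 2 +
    L * (d%:R * K ^+ 2) * alpha k ^+ 2 <= C ->
  Pr.-integrable setT (EFin \o gap k) ->
  Pr.-integrable setT (EFin \o gap k.+1) /\
  \int[Pr]_w gap k.+1 w <=
    (1 - alpha k * (l * (1 - 2 * eps))) * \int[Pr]_w gap k w + C * alpha k ^+ 2.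
Proof.
move=> k0 a0 eps0 eps2 aL; set b := alpha k * _ => b1.
set C0 := (X in X <= C) => C0C ik.
have [mxi mzeta _ _] := sampling.
have C0_ge0 : 0 <= C0.
  have dK : 0 <= d%:R * K ^+ 2 by rewrite mulr_ge0// sqr_ge0.
  have [[L0 e0] a0'] := (ltW L_gt0, ltW eps0, ltW a0).
  apply: addr_ge0; first apply: addr_ge0.
  - by apply: divr_ge0; apply: mulr_ge0.
  - by apply: divr_ge0 => //; apply: mulr_ge0.
  - by apply: mulr_ge0; [apply: mulr_ge0|exact: sqr_ge0].
have ib := integrable_EFinZ (1 - b) ik.
have icst := integrable_EFin_cst Pr (C * alpha k ^+ 2).
have iU := integrable_EFinD ib icst.
have gap0 j w : 0 <= gap j w by rewrite subr_ge0.
apply: integrable_ge0 => //; first exact: gap_meas.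
rewrite gap_freeze//.
apply: (@le_trans _ _ (\int[Pr]_w ((1 - b) * gap k w + C * alpha k ^+ 2)%:E)%E).
  apply: ae_ge0_le_integral => //.
  - move=> w _; apply: integral_ge0 => w' _.
    by rewrite lee_fin subr_ge0.
  - apply: (measurable_fun_fubini_tonelli_F (m2 := Pr) (fun z : Omega * Omega =>
      (F (x k z.1 + sgfd_random_step c f n q alpha xi zeta k (x k z.1) z.2) -
       F xstar)%:E)).
      apply: (@next_gap_meas k _ _ Omega Omega (x k) (xi k) (zeta k) k0).
      + exact: (x_meas k0).
      + move=> i j u; have sk : seeds c n q (inl (k, i, j)) by rewrite /= k0.
        exact: (mxi _ _ _ sk).1.
      + by move=> i u; apply: mzeta; rewrite /= k0.
    by move=> z; rewrite lee_fin subr_ge0.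
  - move=> w _; rewrite lee_fin addr_ge0// mulr_ge0 ?sqr_ge0 ?subr_ge0//.
    exact: le_trans C0C.
  - exact: measurable_int iU.
  - apply: filterS (variance_bound k0) => w varw _.
    apply: (le_trans (sgfd_one_step k0 a0 eps0 eps2 aL varw)).
    rewrite lee_fin -/b -/C0 /gap lerD2l mulrC.
    by rewrite ler_wpM2r// sqr_ge0.
by rewrite EFin_Rintegral// lee_fin RintegralD// RintegralZl// Rintegral_cst1.
Qed.

Lemma expected_gap_decay (beta sigma : R) : (0 < d)%N ->
  l^-1 < beta -> 0 < sigma ->
  (forall k, (0 < k)%N -> alpha k = beta / (k%:R + sigma)) ->
  alpha 1%N <= (L * (MV + 2))^-1 ->
  exists2 nu, 0 <= nu & forall k, (0 < k)%N ->
    Pr.-integrable setT (EFin \o (fun w => F (x k w) - F xstar)) /\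
    \int[Pr]_w (F (x k w) - F xstar) <= nu / (k%:R + 1 + sigma).
Proof.
move=> d0 bl s0 aE a1.
have b0 : 0 < beta by rewrite (lt_trans _ bl)// invr_gt0.
have bl1 : 1 < beta * l by rewrite -ltr_pdivrMr// mul1r.
(* this value makes beta * lam the midpoint of 1 and beta * l *)
pose eps := (1 - (beta * l)^-1) / 4.
have inv1 : (beta * l)^-1 < 1 by rewrite invf_lt1// (lt_trans ltr01).
have inv0 : 0 < (beta * l)^-1 by rewrite invr_gt0 (lt_trans ltr01).
have eps0 : 0 < eps by rewrite /eps; lra.
have eps2 : eps < 2^-1 by rewrite /eps; lra.
pose lam := l * (1 - 2 * eps).
have blam : beta * lam = (beta * l + 1) / 2.
  by rewrite /lam /eps; field; rewrite !gt_eqF.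
have LM0 : 0 < L * (MV + 2) by rewrite mulr_gt0// ltr_wpDl.
have ak0 k : (0 < k)%N -> 0 < alpha k.
  by move=> k0; rewrite aE// divr_gt0// ltr_wpDl.
have ak1 k : (0 < k)%N -> alpha k <= alpha 1%N.
  move=> k0; rewrite !aE// ler_pM2l// lef_pV2 ?posrE ?ltr_wpDl//.
  by rewrite lerD2r ler_nat.
have aLM k : (0 < k)%N -> L * (MV + 2) * alpha k <= 1.
  move=> k0; rewrite mulrC -ler_pdivlMr// mul1r.
  exact: le_trans (ak1 k k0) a1.
(* l <= L makes the contraction factor 1 - alpha k * lam nonnegative *)
have lL := strong_convexity_le_lipschitz L_gt0 F_diff F_lip F_convex d0.
have alam k : (0 < k)%N -> alpha k * lam <= 1.
  move=> k0; apply: le_trans (aLM k k0); rewrite mulrC.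
  rewrite ler_pM2r ?ak0//.
  have l1 : lam <= l by rewrite /lam ler_piMr ?ltW//; lra.
  apply: (le_trans l1); apply: (le_trans lL).
  by apply: ler_peMr; [exact: ltW|move: MV_ge0; lra].
have dK : 0 <= d%:R * K ^+ 2 by rewrite mulr_ge0// sqr_ge0.
pose C := d%:R * K ^+ 2 * alpha 1%N / (4 * eps) + L * M / 2 +
    L * (d%:R * K ^+ 2) * alpha 1%N ^+ 2.
have rec k : (0 < k)%N -> Pr.-integrable setT (EFin \o gap k) ->
  Pr.-integrable setT (EFin \o gap k.+1) /\
  \int[Pr]_w gap k.+1 w <=
    (1 - alpha k * lam) * \int[Pr]_w gap k w + C * alpha k ^+ 2.
  move=> k0; apply: gap_recursion => //; [exact: ak0|exact: aLM|exact: alam|].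
  rewrite /C; apply: lerD; last first.
    apply: ler_wpM2l; first by rewrite mulr_ge0// ltW.
    by rewrite lerXn2r ?nnegrE ?ak1// ltW// ak0.
  rewrite lerD2r; apply: ler_wpM2r; first by rewrite invr_ge0 mulr_ge0// ltW.
  by apply: ler_wpM2l => //; exact: ak1.
have igap k : (0 < k)%N -> Pr.-integrable setT (EFin \o gap k).
  elim: k => // -[_ _|k ih _]; last by apply: (rec k.+1 _ _).1 => //; exact: ih.
  case: run => x1E _; rewrite (_ : gap 1 = fun=> F x1 - F xstar).
    exact: integrable_EFin_cst.
  by apply/funext => w; rewrite /gap x1E.
have C_ge0 : 0 <= C.
  have [[L0 e0] a0'] := (ltW L_gt0, ltW eps0, ltW (ak0 1%N isT)).
  apply: addr_ge0; first apply: addr_ge0.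
  - by apply: divr_ge0; apply: mulr_ge0.
  - by apply: divr_ge0 => //; apply: mulr_ge0.
  - by apply: mulr_ge0; [apply: mulr_ge0|exact: sqr_ge0].
have [|||nu nu0 nuP] := @harmonic_stepsize_decay R beta sigma lam C
    (fun k => \int[Pr]_w gap k w) b0 s0 _ C_ge0.
- by rewrite blam; lra.
- by move=> k; apply: Rintegral_ge0 => w _; rewrite subr_ge0.
- by move=> k k0; rewrite -aE//; exact: (rec k k0 (igap k k0)).2.
by exists nu => // k k0; split; [exact: igap|exact: nuP].
Qed.

End iterates.

(** * Convergence rate *)

Lemma Gamma_ge0 (R : realType) (a : R) : 0 <= Gamma a.
Proof.
by apply: Rintegral_ge0 => t _; rewrite mulr_ge0 ?powR_ge0 ?expR_ge0.
Qed.

Theorem theorem3p10 (R : realType) (d : nat) (d_gt0 : (0 < d)%N)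
    (dX : measure_display) (Xi : measurableType dX) (P : probability Xi R)
    (f : 'rV[R]_d -> Xi -> R)
    (f_measurable :
      measurable_fun setT (fun p : 'rV[R]_d * Xi => f p.1 p.2))
    (f_integrable : forall x, P.-integrable setT (fun u => (f x u)%:E))
    (F : 'rV[R]_d -> R) (F_def : F = objective P f)
    (L : R) (L_gt0 : 0 < L) (F_C1 : continuously_differentiable F)
    (F_lip : lipschitz_gradient F L)
    (l : R) (l_gt0 : 0 < l) (F_convex : strongly_convex F l)
    (xstar : 'rV[R]_d) (xstar_min : unique_minimizer F xstar)
    (dO : measure_display) (Omega : measurableType dO)
    (Pr : probability Omega R)
    (c : sgfd_choice) (n q : nat -> nat)
    (n_gt0 : forall k, (0 < k)%N -> (0 < n k)%N)
    (q_gt0 : forall k, (0 < k)%N -> (0 < q k)%N)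
    (xi : nat -> nat -> nat -> Omega -> Xi)
    (zeta : nat -> nat -> Omega -> 'rV[R]_d)
    (sampling : sgfd_sampling Pr c n q P xi zeta)
    (alpha : nat -> R) (x1 : 'rV[R]_d) (x : nat -> Omega -> 'rV[R]_d)
    (run : sgfd_run c f n q alpha xi zeta x1 x)
    (r m : \bar R)
    (directions : forall k i, seeds c n q (inr (k, i)) ->
      direction_assumption Pr r m (zeta k i))
    (M MV : R) (M_ge0 : 0 <= M) (MV_ge0 : 0 <= MV)
    (variance_bound :
      variance_assumption Pr c f n q alpha xi zeta x F M MV)
    (MG Md : R) (MG_def : MG = MV + 2)
    (Md_def : Md = M + 5 * d%:R ^+ 3 * D_zeta d r m ^+ 2 / 4)
    (beta sigma : R) (beta_gt : l^-1 < beta) (sigma_gt0 : 0 < sigma)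
    (alpha_def : forall k, (0 < k)%N -> alpha k = beta / (k%:R + sigma))
    (alpha1_le : alpha 1%N <= (L * MG)^-1) :
  (exists CA CB : R, [/\ 0 < CA, 0 < CB &
    forall k : nat, (0 < k)%N ->
      ('E_Pr[fun w => F (x k w)] - (F xstar)%:E <=
       (CA * Gamma (1 + sigma) / Gamma (1 + sigma - beta * l) *
          ((F x1 - F xstar) / (k%:R + 1 + sigma) `^ (beta * l)) +
        CB * beta ^+ 2 / (2 * (beta * l - 1)) *
          (L * Md / (k%:R + 1 + sigma)))%:E)%E]) /\
  (fun k : nat => fine 'E_Pr[fun w => F (x k w)]%E - F xstar) =O_\oo
    (fun k : nat => k%:R^-1 : R).
Proof.
subst F MG Md; case: F_C1 => F_diff _.
have [Fmin _] := xstar_min.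
have [m4 m4_ge0 m4_bound] := @fourth_moment_bound R d dO Omega Pr r m.
have [_ mzeta _ _] := sampling.
have zeta_m4 k i : seeds c n q (inr (k, i)) ->
    forall j, (\int[Pr]_w ((zeta k i w ord0 j ^+ 4)%:E) <= m4%:E)%E.
  by move=> ki; apply: m4_bound; [exact: mzeta|exact: directions].
have [nu nu0 nuP] := expected_gap_decay f_measurable f_integrable L_gt0 l_gt0
  F_diff F_lip F_convex Fmin n_gt0 q_gt0 sampling run directions M_ge0 MV_ge0
  variance_bound zeta_m4 d_gt0 beta_gt sigma_gt0 alpha_def alpha1_le.
have seed0 : seeds c n q (inr (1, 0))%N.
  by rewrite /seeds /=; case: (c) => //=; rewrite n_gt0.
have D1 : 1 <= D_zeta d r m.
  exact: (D_zeta_ge1 d_gt0 (mzeta _ _ seed0) (directions _ _ seed0)).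
set Fs := objective P f xstar in nuP *.
set Md := M + _; have Md0 : 0 < Md.
  rewrite ltr_wpDl// divr_gt0// mulr_gt0//; last first.
    by rewrite exprn_gt0// (lt_le_trans _ D1).
  by rewrite mulr_gt0// exprn_gt0// ltr0n.
have bl1 : 1 < beta * l by rewrite -ltr_pdivrMr// mul1r.
have b0 : 0 < beta by rewrite (lt_trans _ beta_gt)// invr_gt0.
have gap_expectation k : (0 < k)%N ->
    'E_Pr[fun w => objective P f (x k w)]%E =
    (\int[Pr]_w (objective P f (x k w) - Fs) + Fs)%:E.
  move=> k0; have [ik _] := nuP k k0.
  have ik' := integrable_EFinD ik (integrable_EFin_cst Pr Fs).
  rewrite unlock EFinD -EFin_Rintegral// -(integral_EFin_cst1 Pr Fs).
  rewrite -integralD//; last exact: integrable_EFin_cst.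
  by apply: eq_integral => w _; rewrite -EFinD subrK.
split; last first.
  apply/eqO_exP; exists (nu + 1); first by lra.
  exists 1%N => // k /= k0; rewrite gap_expectation//= addrK.
  rewrite ger0_norm; last by apply: Rintegral_ge0 => w _; rewrite subr_ge0.
  apply: (le_trans (nuP k k0).2).
  have k1 : 0 < k%:R :> R by rewrite ltr0n.
  rewrite ger0_norm ?invr_ge0 ?ler0n//.
  apply: (@le_trans _ _ (nu / k%:R)); last by rewrite ler_pM2r ?invr_gt0//; lra.
  by apply: ler_wpM2l => //; rewrite lef_pV2 ?posrE//; lra.
(* this C_B makes the second term of the bound (nu + 1) / (k + 1 + sigma) *)
exists 1, ((nu + 1) * (2 * (beta * l - 1)) / (beta ^+ 2 * L * Md)); split => //.
  by rewrite divr_gt0 ?mulr_gt0 ?exprn_gt0//; lra.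
move=> k k0; rewrite gap_expectation// -EFinB lee_fin addrK.
have kpos : 0 < k%:R + 1 + sigma by rewrite ltr_wpDl// addr_ge0.
apply: (le_trans (nuP k k0).2).
rewrite -[leLHS]add0r; apply: lerD.
  rewrite mul1r mulr_ge0 ?divr_ge0 ?Gamma_ge0 ?powR_ge0 ?subr_ge0//.
have -> : (nu + 1) * (2 * (beta * l - 1)) / (beta ^+ 2 * L * Md) * beta ^+ 2 /
    (2 * (beta * l - 1)) * (L * Md / (k%:R + 1 + sigma)) =
    (nu + 1) / (k%:R + 1 + sigma).
  by field; rewrite !gt_eqF//; lra.
by rewrite ler_pM2r ?invr_gt0//; lra.
Qed.
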